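(* Let $p\in[1,\infty)$. Let $(\rho_{st})_{0\le s\le t\le T}$ be a strong time-consistent fully-dynamic convex risk measure on $(L_p(\mathcal F_t))_t$ such that $\rho_{0T}$ is dominated and sensitive. For all $s\le t$, the operator $x_{st}:L^c_t\to L^c_s$ defined by $$x_{st}(X):=\operatorname*{ess\,inf}_{g\in\mathcal C^\infty_{st}}\tilde\rho_{st}(g-X)-\operatorname*{ess\,inf}_{g\in\mathcal C^\infty_{st}}\tilde\rho_{st}(g)$$ has the Fatou property on $L^c_t$: for any sequence $(X_n)_n$ in $L^c_t$ which is dominated in $L^c_t$ (i.e. there is $Y\in L^c_t$ with $|X_n|\le Y$ $P$-a.s. for all $n$) and converges $P$-a.s. to $X\in L^c_t$, $$x_{st}(X)\le\liminf_{n\to\infty}x_{st}(X_n).$$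
   Context: Let $T\in(0,\infty)$ and let $(\Omega,\mathcal F,(\mathcal F_t)_{t\in[0,T]},P)$ be a complete filtered probability space with $\mathcal F_0$ trivial; $L_p(\mathcal F_t)=L_p(\Omega,\mathcal F_t,P)$, $E_Q$ is expectation under $Q$. Relations between random variables hold $P$-a.s. Risk measures: a fully-dynamic convex risk measure on $(L_p(\mathcal F_t))_t$ ($p<\infty$) is a family of mappings $\rho_{st}:L_p(\mathcal F_t)\to L_p(\mathcal F_s)$, $0\le s\le t\le T$, each monotone ($\rho_{st}(X')\le\rho_{st}(X'')$ if $X'\ge X''$), convex, and $\mathcal F_s$-translation invariant ($\rho_{st}(X+f)=\rho_{st}(X)-f$, $f\in L_p(\mathcal F_s)$). Strong time-consistent: $\rho_{rt}(X)=\rho_{rs}(-\rho_{st}(X))$ for all $r\le s\le t$, $X\in L_p(\mathcal F_t)$. Minimal penalty: $\alpha_{st}(Q)=\operatorname{ess\,sup}_{X\in L_p(\mathcal F_t)}(E_Q(-X|\mathcal F_s)-\rho_{st}(X))$. $\rho_{0T}$ is dominated if there is a sublinear (coherent) risk measure $\bar\rho:L_p(\mathcal F_T)\to\mathbb R$ with $\rho_{0T}(X)-\rho_{0T}(0)\le\bar\rho(X)$ for all $X$; it is sensitive if there is a probability measure $\tilde Q\sim P$ on $\mathcal F_T$ with $\alpha_{0T}(\tilde Q)<\infty$. Extension: $\mathcal Q=\{Q\sim P:\ \alpha_{0T}(Q)<\infty\}$ (on $\mathcal F_T$); $c(X)=\sup_{Q\in\mathcal Q}E_Q(|X|)$. $L^c_t$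 is the Banach space obtained by completing the essentially bounded $\mathcal F_t$-measurable random variables for $c$ (and quotienting by $c(X-Y)=0$); for all $Q\in\mathcal Q$, $L_p(\mathcal F_t,P)\subseteq L^c_t\subseteq L_1(\mathcal F_t,Q)$. $\tilde\rho_{st}:L^c_t\to L^c_s$ is the unique extension of $\rho_{st}$ such that $c(|\tilde\rho_{st}(X)-\tilde\rho_{st}(Y)|)\le c(|X-Y|)$ for all $X,Y\in L^c_t$ (it exists under the present assumptions). Market: $(\Pi_t)_{t\in[0,T]}$ is an adapted locally bounded $\mathbb R^d$-valued semimartingale; for a predictable $\Pi$-integrable $\mathbb R^d$-valued $\theta$, $Y_{st}(\theta)=\int_s^t\theta_u\,d\Pi_u$. $\Xi$ is the set of all such $\theta$ for which, for every $s$, the integral process $(Y_{st}(\theta))_t$ is adapted and bounded from below. The set of admissible strategies is a fixed convex $\Theta\subseteq\Xi$ with $0\in\Theta$ ($Y_{st}(0)=0$), stable in the sense that for all $s$, $A\in\mathcal F_s$, $\theta^{(1)},\theta^{(2)},\theta^{(3)}\in\Theta$, the strategy equal to $\theta^{(1)}$ on $(0,s]$ and $1_A\theta^{(2)}+1_{A^c}\theta^{(3)}$ on $(s,T]$ lies in $\Theta$. For $p'\in[1,\infty]$, $\mathcal C^{p'}_{st}=\{g\in L_{p'}(\mathcal F_t):\exists\,\theta\in\Theta,\ g\le Y_{st}(\theta)\}$. Standing assumption: $\operatorname{ess\,inf}_{g\in\mathcal C^p_{st}}\rho_{st}(g)>-\infty$ $P$-a.s. for all $s\le t$. *)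

(* Defs.v *)
From mathcomp Require Import all_boot all_order all_algebra.
From mathcomp Require Import all_classical all_reals all_analysis.
From mathcomp Require Import measurable_realfun.

Set Implicit Arguments.
Unset Strict Implicit.
Unset Printing Implicit Defensive.
Import Order.TTheory GRing.Theory Num.Theory.
Import numFieldNormedType.Exports.

Local Open Scope classical_set_scope.
Local Open Scope ring_scope.

(* Random variables are functions; all relations between them hold P-a.s.     *)

Section random_variables.
Context {d : measure_display} {Om : measurableType d} {R : realType}.
Context (P : probability Om R).

Definition gmeasurable (G : set (set Om)) {d'} {U : measurableType d'}
    (X : Om -> U) : Prop :=
  measurable_fun (setT : set (g_sigma_algebraType G)) X.

Definition Lp (G : set (set Om)) (p : \bar R) (X : Om -> R) : Prop :=
  gmeasurable G X /\ ('N[P]_p[EFin \o X] < +oo)%E.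

(* Complete filtered probability space on [0, T], no right-continuity: the    *)
(* last clause puts all subsets of P-null events in F_0 (hence in every F_t   *)
(* and in the ambient sigma-algebra).                                         *)
Definition complete_filtration (T : R) (F : R -> set (set Om)) : Prop :=
  [/\ forall t, 0 <= t <= T ->
        sigma_algebra [set: Om] (F t) /\ F t `<=` measurable,
      forall s t, 0 <= s -> s <= t -> t <= T -> F s `<=` F t
    & forall N, P.-negligible N -> F 0 N].

Definition trivial_sigma (G : set (set Om)) : Prop :=
  forall A, G A -> P A = 0%E \/ P A = 1%E.

Definition is_esssup (G : set (set Om)) (S : set (Om -> \bar R))
    (Z : Om -> \bar R) : Prop :=
  [/\ gmeasurable G Z,
      forall Y, S Y -> {ae P, forall w, (Y w <= Z w)%E}
    & forall Z', gmeasurable G Z' ->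
        (forall Y, S Y -> {ae P, forall w, (Y w <= Z' w)%E}) ->
        {ae P, forall w, (Z w <= Z' w)%E}].

Definition is_essinf (G : set (set Om)) (S : set (Om -> \bar R))
    (Z : Om -> \bar R) : Prop :=
  [/\ gmeasurable G Z,
      forall Y, S Y -> {ae P, forall w, (Z w <= Y w)%E}
    & forall Z', gmeasurable G Z' ->
        (forall Y, S Y -> {ae P, forall w, (Z' w <= Y w)%E}) ->
        {ae P, forall w, (Z' w <= Z w)%E}].

(* A version of the essential supremum (infimum) of a family of G-measurable  *)
(* extended random variables; versions exist and are a.s. unique, so the      *)
(* default values are never used.                                             *)
Definition esssup_fam (G : set (set Om)) (S : set (Om -> \bar R)) :
    Om -> \bar R :=
  xget (cst -oo%E) [set Z | is_esssup G S Z].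

Definition essinf_fam (G : set (set Om)) (S : set (Om -> \bar R)) :
    Om -> \bar R :=
  xget (cst +oo%E) [set Z | is_essinf G S Z].

End random_variables.

Section conditional_expectation.
Context {d : measure_display} {Om : measurableType d} {R : realType}.
Context (Q : probability Om R).
Local Open Scope ereal_scope.

Definition is_condexp_ge0 (G : set (set Om)) (X Z : Om -> \bar R) : Prop :=
  [/\ gmeasurable G Z, forall w, 0 <= Z w
    & forall A, G A -> \int[Q]_(w in A) Z w = \int[Q]_(w in A) X w].

(* Generalized conditional expectation E(X^+|G) - E(X^-|G), so that no        *)
(* integrability is needed; +oo - +oo = -oo in \bar R, so an X for which      *)
(* E_Q(X|G) is undefined does not contribute to a supremum.                   *)
Definition is_condexp (G : set (set Om)) (X Z : Om -> \bar R) : Prop :=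
  exists Zp Zn, [/\ is_condexp_ge0 G (X^\+) Zp, is_condexp_ge0 G (X^\-) Zn
    & Z = (fun w => Zp w - Zn w)].

End conditional_expectation.

Section risk_measures.
Context {d : measure_display} {Om : measurableType d} {R : realType}.
Context (P : probability Om R) (T : R) (F : R -> set (set Om)) (p : R).

Notation Lp_ := (fun t => Lp P (F t) p%:E).

Definition convex_risk_measure
    (rho : R -> R -> (Om -> R) -> (Om -> R)) : Prop :=
  forall s t, 0 <= s -> s <= t -> t <= T ->
  [/\ forall X, Lp_ t X -> Lp_ s (rho s t X),
      forall X' X'', Lp_ t X' -> Lp_ t X'' ->
        {ae P, forall w, X'' w <= X' w} ->
        {ae P, forall w, rho s t X' w <= rho s t X'' w},
      forall X' X'' (a : R), Lp_ t X' -> Lp_ t X'' -> 0 <= a <= 1 ->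
        {ae P, forall w, rho s t (fun v => a * X' v + (1 - a) * X'' v) w <=
                         a * rho s t X' w + (1 - a) * rho s t X'' w}
    & forall X f, Lp_ t X -> Lp_ s f ->
        {ae P, forall w, rho s t (fun v => X v + f v) w = rho s t X w - f w}].

Definition strong_time_consistent
    (rho : R -> R -> (Om -> R) -> (Om -> R)) : Prop :=
  forall r s t, 0 <= r -> r <= s -> s <= t -> t <= T ->
  forall X, Lp_ t X ->
  {ae P, forall w, rho r t X w = rho r s (fun v => - rho s t X v) w}.

Definition coherent_risk_measure (rhobar : (Om -> R) -> R) : Prop :=
  [/\ forall X' X'', Lp_ T X' -> Lp_ T X'' ->
        {ae P, forall w, X'' w <= X' w} -> rhobar X' <= rhobar X'',
      forall X' X'', Lp_ T X' -> Lp_ T X'' ->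
        rhobar (fun w => X' w + X'' w) <= rhobar X' + rhobar X'',
      forall X (a : R), Lp_ T X -> 0 <= a ->
        rhobar (fun w => a * X w) = a * rhobar X
    & forall X (a : R), Lp_ T X -> rhobar (fun w => X w + a) = rhobar X - a].

Definition dominated (rho : R -> R -> (Om -> R) -> (Om -> R)) : Prop :=
  exists2 rhobar, coherent_risk_measure rhobar &
    forall X, Lp_ T X ->
    {ae P, forall w, rho 0 T X w - rho 0 T (cst 0) w <= rhobar X}.

(* Probability measures on F_T are measures on g_sigma_algebraType (F T),     *)
(* whose measurable sets are those of F T.                                    *)
Definition min_penalty (rho : R -> R -> (Om -> R) -> (Om -> R)) (s t : R)
    (Q : probability (g_sigma_algebraType (F T)) R) : Om -> \bar R :=
  esssup_fam P (F s) [set Z | exists X C, [/\ Lp_ t X,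
    is_condexp Q (F s) (fun w => (- X w)%:E) C
    & Z = (fun w => (C w - (rho s t X w)%:E)%E)]].

Definition equiv_measure
    (Q : probability (g_sigma_algebraType (F T)) R) : Prop :=
  forall A, F T A -> (Q A = 0%E <-> P A = 0%E).

Definition calQ (rho : R -> R -> (Om -> R) -> (Om -> R)) :
    set (probability (g_sigma_algebraType (F T)) R) :=
  [set Q | equiv_measure Q /\
    {ae P, forall w, (min_penalty rho 0 T Q w < +oo)%E}].

Definition sensitive (rho : R -> R -> (Om -> R) -> (Om -> R)) : Prop :=
  exists Q, calQ rho Q.

Definition cnorm (rho : R -> R -> (Om -> R) -> (Om -> R)) (X : Om -> R) :
    \bar R :=
  ereal_sup [set (\int[Q]_w `|(X w)%:E|)%E | Q in calQ rho].

(* The completion of L_oo(F_t) for c, realized as the c-closure of L_oo(F_t)  *)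
(* in the F_t-measurable random variables with c finite, which is complete    *)
(* (c is a supremum of L_1-norms); c(X - Y) = 0 iff X = Y a.s.                *)
Definition Lc (rho : R -> R -> (Om -> R) -> (Om -> R)) (t : R)
    (X : Om -> R) : Prop :=
  gmeasurable (F t) X /\
  forall e : R, 0 < e -> exists2 B, Lp P (F t) +oo%E B &
    (cnorm rho (fun w => X w - B w)%R <= e%:E)%E.

Definition is_extension (rho rhot : R -> R -> (Om -> R) -> (Om -> R)) :
    Prop :=
  forall s t, 0 <= s -> s <= t -> t <= T ->
  [/\ forall X, Lc rho t X -> Lc rho s (rhot s t X),
      forall X, Lp_ t X -> {ae P, forall w, rhot s t X w = rho s t X w}
    & forall X Y, Lc rho t X -> Lc rho t Y ->
        (cnorm rho (fun w => rhot s t X w - rhot s t Y w)%R <=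
         cnorm rho (fun w => X w - Y w)%R)%E].

End risk_measures.

Section stochastic_integral.
Context {d : measure_display} {Om : measurableType d} {R : realType}.
Context (P : probability Om R) (T : R) (F : R -> set (set Om)).

Definition adapted (X : R -> Om -> R) : Prop :=
  forall t, 0 <= t <= T -> gmeasurable (F t) (X t).

Definition cadlag (X : R -> Om -> R) : Prop :=
  {ae P, forall w,
    (forall t, 0 <= t < T -> X u w @[u --> t^'+] --> X t w) /\
    (forall t, 0 < t <= T -> cvg (X u w @[u --> t^'-]))}.

Definition stopping_time (tau : Om -> R) : Prop :=
  (forall w, 0 <= tau w <= T) /\
  forall t, 0 <= t <= T -> F t [set w | tau w <= t].

Definition stopped (X : R -> Om -> R) (tau : Om -> R) : R -> Om -> R :=
  fun t w => X (Num.min t (tau w)) w.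

Definition localizing (tau : nat -> Om -> R) : Prop :=
  [/\ forall n, stopping_time (tau n),
      forall n w, tau n w <= tau n.+1 w
    & {ae P, forall w, exists n, tau n w = T}].

Definition martingale (M : R -> Om -> R) : Prop :=
  [/\ adapted M,
      forall t, 0 <= t <= T -> P.-integrable [set: Om] (EFin \o M t)
    & forall s t A, 0 <= s -> s <= t -> t <= T -> F s A ->
        (\int[P]_(w in A) (M t w)%:E = \int[P]_(w in A) (M s w)%:E)%E].

Definition local_martingale (M : R -> Om -> R) : Prop :=
  [/\ adapted M, cadlag M
    & exists2 tau, localizing tau & forall n, martingale (stopped M (tau n))].

Definition semimartingale (X : R -> Om -> R) : Prop :=
  exists M A, [/\ local_martingale M,
    [/\ adapted A, cadlag A
      & {ae P, forall w, bounded_variation 0 T (fun t => A t w)}]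
    & forall t w, 0 <= t <= T -> X t w = M t w + A t w].

Definition locally_bounded (X : R -> Om -> R) : Prop :=
  exists2 tau, localizing tau & forall n, exists K : R,
    {ae P, forall w, forall t, 0 <= t <= T -> `|stopped X (tau n) t w| <= K}.

Definition vadapted m (X : R -> Om -> 'rV[R]_m) : Prop :=
  forall i, adapted (fun t w => X t w ord0 i).

Definition vsemimartingale m (X : R -> Om -> 'rV[R]_m) : Prop :=
  forall i, semimartingale (fun t w => X t w ord0 i).

Definition vlocally_bounded m (X : R -> Om -> 'rV[R]_m) : Prop :=
  forall i, locally_bounded (fun t w => X t w ord0 i).

Definition predictable_gen : set (set (R * Om)) :=
  [set E | (exists2 A, F 0 A & E = [set 0] `*` A) \/
           (exists u v A, [/\ 0 <= u, u < v, v <= T, F u A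
                            & E = `]u, v]%classic `*` A])].

Definition predictable m (H : R -> Om -> 'rV[R]_m) : Prop :=
  forall i, measurable_fun
    (`[0, T]%classic `*` [set: Om] : set (g_sigma_algebraType predictable_gen))
    (fun z : R * Om => H z.1 z.2 ord0 i).

(* Uniform convergence in probability on [0, T], written without assuming     *)
(* that the supremum over t is measurable.                                    *)
Definition small_in_prob (e delta : R) (Z : R -> Om -> R) : Prop :=
  exists A, [/\ measurable A, (P A <= delta%:E)%E
    & forall t w, 0 <= t <= T -> ~ A w -> `|Z t w| <= e].

Definition ucp (Y : nat -> R -> Om -> R) (Yoo : R -> Om -> R) : Prop :=
  forall e delta : R, 0 < e -> 0 < delta -> \forall n \near \oo,
    small_in_prob e delta (fun t w => Y n t w - Yoo t w).

(* bounded_integral X H Y: Y is a version of the process int_(0,.] H dX, for  *)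
(* a bounded predictable H. It is the extension of the elementary integral    *)
(* by linearity and by dominated convergence in ucp; for a semimartingale X   *)
(* it is defined for every bounded predictable H, uniquely up to              *)
(* indistinguishability. Values of H outside [0, T] are irrelevant, and time  *)
(* 0 carries no mass.                                                         *)
Inductive bounded_integral m (X : R -> Om -> 'rV[R]_m) :
    (R -> Om -> 'rV[R]_m) -> (R -> Om -> R) -> Prop :=
| bint_zero (i : 'I_m) (A : set Om) : F 0 A ->
    bounded_integral X
      (fun t w => (\1_[set (0 : R)] t * \1_A w) *: delta_mx ord0 i)
      (fun=> cst 0)
| bint_elem (i : 'I_m) (u v : R) (A : set Om) :
    0 <= u -> u < v -> v <= T -> F u A ->
    bounded_integral X
      (fun t w => (\1_(`]u, v]%classic) t * \1_A w) *: delta_mx ord0 i)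
      (fun t w => \1_A w *
         (X (Num.min t v) w ord0 i - X (Num.min t u) w ord0 i))
| bint_lin (a : R) (H1 H2 : R -> Om -> 'rV[R]_m) (Y1 Y2 : R -> Om -> R) :
    bounded_integral X H1 Y1 -> bounded_integral X H2 Y2 ->
    bounded_integral X (fun t w => a *: H1 t w + H2 t w)
                       (fun t w => a * Y1 t w + Y2 t w)
| bint_lim (Hn : nat -> R -> Om -> 'rV[R]_m) (Yn : nat -> R -> Om -> R)
    (H : R -> Om -> 'rV[R]_m) (Y : R -> Om -> R) (K : R) :
    (forall n, bounded_integral X (Hn n) (Yn n)) ->
    (forall n t w i, 0 <= t <= T -> `|Hn n t w ord0 i| <= K) ->
    (forall t w i, 0 <= t <= T ->
       Hn n t w ord0 i @[n --> \oo] --> H t w ord0 i) ->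
    ucp Yn Y ->
    bounded_integral X H Y.

(* Convergence in Emery's semimartingale topology of processes starting at 0: *)
(* int K d(Y_n - Y) -> 0 in ucp, uniformly over the predictable K with        *)
(* |K| <= 1.                                                                  *)
Definition emery_cvg (Y : nat -> R -> Om -> R) (Yoo : R -> Om -> R) : Prop :=
  forall e delta : R, 0 < e -> 0 < delta -> \forall n \near \oo,
    forall (K : R -> Om -> 'rV[R]_1) (Z : R -> Om -> R),
      (forall t w, 0 <= t <= T -> `|K t w ord0 ord0| <= 1) ->
      bounded_integral (fun t w => const_mx (Y n t w - Yoo t w)) K Z ->
      small_in_prob e delta Z.

Definition truncated m (n : nat) (H : R -> Om -> 'rV[R]_m) :
    R -> Om -> 'rV[R]_m :=
  fun t w => if [forall i, `|H t w ord0 i| <= n%:R] then H t w else 0.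

(* The (vector) stochastic integral Y = int_(0,.] H dX of a predictable H, as *)
(* defined by Chou, Meyer and Stricker: H is X-integrable iff the integrals   *)
(* of H 1_{|H| <= n} converge in the semimartingale topology, and the limit   *)
(* is the integral. It is unique up to indistinguishability.                  *)
Definition is_integral m (X : R -> Om -> 'rV[R]_m) (H : R -> Om -> 'rV[R]_m)
    (Y : R -> Om -> R) : Prop :=
  [/\ predictable H, semimartingale Y, {ae P, forall w, Y 0 w = 0}
    & exists2 Yn, forall n, bounded_integral X (truncated n H) (Yn n)
                & emery_cvg Yn Y].

End stochastic_integral.

Section market.
Context {d : measure_display} {Om : measurableType d} {R : realType}.
Context (P : probability Om R) (T : R) (F : R -> set (set Om)).
Context (m : nat) (Pi : R -> Om -> 'rV[R]_m).

Definition Xi : set (R -> Om -> 'rV[R]_m) :=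
  [set theta | exists2 Y, is_integral P T F Pi theta Y &
    forall s, 0 <= s <= T ->
      (forall t, s <= t <= T -> gmeasurable (F t) (fun w => Y t w - Y s w)) /\
      exists K : R,
        {ae P, forall w, forall t, s <= t <= T -> K <= Y t w - Y s w}].

Definition concat (s : R) (A : set Om) (th1 th2 th3 : R -> Om -> 'rV[R]_m) :
    R -> Om -> 'rV[R]_m :=
  fun u w => if u <= s then th1 u w
             else \1_A w *: th2 u w + \1_(~` A) w *: th3 u w.

Definition admissible_strategies (Theta : set (R -> Om -> 'rV[R]_m)) : Prop :=
  [/\ Theta `<=` Xi,
      Theta (fun=> cst 0),
      forall th1 th2 (a : R), Theta th1 -> Theta th2 -> 0 <= a <= 1 ->
        Theta (fun u w => a *: th1 u w + (1 - a) *: th2 u w)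
    & forall s A th1 th2 th3, 0 <= s <= T -> F s A ->
        Theta th1 -> Theta th2 -> Theta th3 -> Theta (concat s A th1 th2 th3)].

Context (Theta : set (R -> Om -> 'rV[R]_m)).

(* Y t - Y s is a version of Y_st(theta). *)
Definition hedgeable (q : \bar R) (s t : R) : set (Om -> R) :=
  [set g | Lp P (F t) q g /\ exists theta Y,
    [/\ Theta theta, is_integral P T F Pi theta Y
      & {ae P, forall w, g w <= Y t w - Y s w}]].

Definition no_free_hedge (p : R) (rho : R -> R -> (Om -> R) -> (Om -> R)) :
    Prop :=
  forall s t, 0 <= s -> s <= t -> t <= T ->
  {ae P, forall w, (-oo < essinf_fam P (F s)
    [set (EFin \o rho s t g) | g in hedgeable p%:E s t] w)%E}.

Definition price (rhot : R -> R -> (Om -> R) -> (Om -> R)) (s t : R)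
    (X : Om -> R) : Om -> \bar R :=
  fun w =>
  (essinf_fam P (F s)
     [set (EFin \o rhot s t (fun v => g v - X v)%R)
       | g in hedgeable +oo s t] w -
   essinf_fam P (F s)
     [set (EFin \o rhot s t g) | g in hedgeable +oo s t] w)%E.

End market.

(* Main.v *)
Require Import Defs.
From mathcomp Require Import all_boot all_order all_algebra.
From mathcomp Require Import all_classical all_reals all_analysis.
From mathcomp Require Import measurable_realfun ess_sup_inf ring lra.
Import Order.TTheory GRing.Theory Num.Theory.
Import numFieldNormedType.Exports.
Local Open Scope classical_set_scope.
Local Open Scope ring_scope.

(* Domination makes every [Q] in [calQ] satisfy [E_Q X <= rhobar (- X)] on
   nonnegative [X], so that [c] is uniformly absolutely continuous with respect
   to [P] and dominated a.s. convergence in [L^c] implies convergence for [c].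
   Let [U X] be the essential infimum over the hedges [g] of [rhot (g - X)].
   Monotonicity and translation invariance make [rhot] local, and pasting hedges
   along events of [F_s] transfers the [c]-contraction property of [rhot] to the
   inequality [c ((U Y - U X)^+) <= c (X - Y)], although the pasted variables need
   not be hedges.  Applied to bounded approximations, this puts the price
   [U X - U 0] in [L^c_s].  For the Fatou property, [Z_n = inf_(k >= n) X_k]
   increases to [X], the price of [Z_n] is below that of [X_k] for [k >= n],
   hence below the liminf, and [c ((U X - U Z_n)^+) <= c (Z_n - X)] tends to 0. *)

(** * Essential infima *)

Section gmeasurable.
Context {d : measure_display} {Om : measurableType d}.
Implicit Types (G H : set (set Om)).

(** The contraction property of [rhot] compares the risks of [G - X] and [G - Y] for one and the
    same [G], and only after integration, whereas [U X] may be approached by different hedges on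
    different events. What is needed is one [G] that is nearly optimal for [X] everywhere and whose
    risk against [Y] is still at least [U Y]; the second requirement holds on each piece, so it
    survives pasting even when [G] leaves the set of hedges. The resulting inequality is one-sided
    and asks for finiteness of [U Y] alone: with [Y = 0] it shows that [U X] is finite, and its
    instances for [X, Y] and for [Y, X] together control [|U X - U Y|]. In the last step,
    convergence for [c] gives no a.s. convergence of [U Z_n]; it does force the infimum over [n] of
    the deficits [(U X - U Z_n)^+] to vanish a.s., which suffices because the price of every [Z_n]
    lies below the liminf. *)

Lemma gmeasurable_sub G H {d'} {U : measurableType d'} (X : Om -> U) :
  G `<=` H -> gmeasurable G X -> gmeasurable H X.
Proof.
move=> GH mX _ B mB.
exact: sub_sigma_algebra2 GH _ (mX measurableT B mB).
Qed.

Lemma gmeasurable_measurable G {d'} {U : measurableType d'} (X : Om -> U) :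
  G `<=` measurable -> gmeasurable G X -> measurable_fun setT X.
Proof.
move=> Gm mX _ B mB.
have : <<s G >> `<=` measurable.
  apply: smallest_sub => //; exact: sigma_algebra_measurable.
by apply; exact: mX.
Qed.

Lemma gmeasurable_preimage G {d'} {U : measurableType d'} (X : Om -> U) B :
  sigma_algebra setT G -> gmeasurable G X -> measurable B -> G (X @^-1` B).
Proof.
move=> sG mX mB; rewrite -(sigma_algebra_id sG).
by have := mX measurableT B mB; rewrite setTI.
Qed.

Lemma gmeasurable_set G (A : set Om) :
  sigma_algebra setT G -> G A -> measurable (A : set (g_sigma_algebraType G)).
Proof. by move=> sG GA; apply: sub_sigma_algebra. Qed.

End gmeasurable.

Lemma limn_einf_ge {R : realType} (u : nat -> \bar R) i a :
  (forall k, (i <= k)%N -> a <= u k)%E -> (a <= limn_einf u)%E.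
Proof.
move=> au; rewrite limn_einf_lim (cvg_lim _ (@cvg_einfs_sup _ u))//.
apply: (@le_trans _ _ (einfs u i)); last by apply: ereal_sup_ubound; exists i.
by apply: le_ereal_inf_tmp => _ [k /= ik <-]; exact: au.
Qed.

Lemma limn_einf_le {R : realType} (u : nat -> \bar R) a :
  (forall k, u k <= a)%E -> (limn_einf u <= a)%E.
Proof.
move=> ua; rewrite limn_einf_lim (cvg_lim _ (@cvg_einfs_sup _ u))//.
apply: ge_ereal_sup => _ [i _ <-]; apply: le_trans (ua i).
by apply: ereal_inf_lbound; exists i => /=.
Qed.

Section essential_infimum.
Context {d : measure_display} {Om : measurableType d} {R : realType}.
Context (P : probability Om R).
Local Open Scope ereal_scope.

Lemma measurable_contract :
  measurable_fun [set: \bar R] (@contract R).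
Proof.
rewrite (_ : @contract R = fun x => if x \is a fin_num
   then (fine x / (1 + `|fine x|))%R else
   if x == +oo then 1%R else (-1)%R); last by apply/funext => -[].
apply: measurable_fun_ifT => /=.
- by apply: (measurable_fun_bool true); exact/emeasurable_fin_num.
- have mf : measurable_fun [set: R] (fun x : R => x / (1 + `|x|))%R.
    apply: continuous_measurable_fun => x.
    apply: cvgM; first exact: cvg_id.
    apply: cvgV; first by rewrite gt_eqF// ltr_pwDl.
    by apply: cvgD; [exact: cvg_cst|apply: cvg_norm; exact: cvg_id].
  exact: (measurableT_comp mf).
- apply: measurable_fun_ifT => //=.
  apply: (measurable_fun_bool true) => //=.
  rewrite [X in measurable X](_ : _ = [set +oo]) ?setTI.
    exact: emeasurable_set1.
  by apply/seteqP; split => x /= => [/eqP|->].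
Qed.

(** A strictly increasing map of the extended line into [[0, 2]]: its integrals are finite, and two
    ordered variables with the same integral of [phi] agree a.s. *)
Let phi (x : \bar R) : \bar R := (1 + contract x)%:E.

Let phi_ge0 x : 0 <= phi x.
Proof.
rewrite lee_fin -lerBlDl sub0r.
by have := contract_le1 x; rewrite ler_norml => /andP[].
Qed.

Let phi_le2 x : phi x <= 2%:E.
Proof.
rewrite lee_fin (_ : 2 = 1 + 1)%R// lerD2l.
by have := contract_le1 x; rewrite ler_norml => /andP[].
Qed.

Let le_phi x y : x <= y -> phi x <= phi y.
Proof. by move=> xy; rewrite lee_fin lerD2l le_contract. Qed.

Let lt_phi x y : x < y -> phi x < phi y.
Proof. by move=> xy; rewrite lte_fin ltrD2l lt_contract. Qed.

Let mphi (f : Om -> \bar R) : measurable_fun setT f ->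
  measurable_fun setT (phi \o f).
Proof.
move=> mf; apply/measurable_EFinP; apply: measurable_funD => //.
exact: measurableT_comp measurable_contract mf.
Qed.

Lemma measurable_inf_range d' (T : measurableType d') (f : nat -> T -> \bar R) :
  (forall n, measurable_fun setT (f n)) ->
  measurable_fun setT (fun w => ereal_inf (range (f^~ w))).
Proof.
move=> mf.
rewrite (_ : (fun w => _) = (fun w => einfs (f^~ w) 0%N)).
  exact: measurable_fun_einfs.
apply/funext => w; congr ereal_inf; apply/seteqP.
by split => x [n _ <-]; exists n.
Qed.

(** The family is not assumed directed, so the minimization of the integral of [phi] runs over
    infima of sequences in [S]. Countably many sequences merge into one, hence the minimum is
    attained; a countable infimum is measurable and is the greatest a.s. lower bound as soon as it
    is one. *)
Lemma essinf_seq (G : set (set Om)) (S : set (Om -> \bar R)) :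
  G `<=` measurable -> S !=set0 -> (forall Y, S Y -> gmeasurable G Y) ->
  exists2 f : nat -> Om -> \bar R, (forall n, S (f n)) &
    is_essinf P G S (fun w => ereal_inf (range (f^~ w))).
Proof.
move=> Gm [Y0 SY0] SG.
have Sm Y : S Y -> measurable_fun setT Y.
  by move=> /SG; exact: gmeasurable_measurable.
pose I (f : nat -> Om -> \bar R) w := ereal_inf (range (f^~ w)).
pose J f := \int[P]_w phi (I f w).
pose K := [set J f | f in [set f | forall n, S (f n)]].
have mI f : (forall n, S (f n)) -> measurable_fun setT (I f).
  by move=> Sf; apply: measurable_inf_range => n; exact: Sm.
have J2 f : (forall n, S (f n)) -> J f <= 2%:E.
  move=> Sf; apply: (@le_trans _ _ (\int[P]_w (cst 2%:E w))).
    by apply: ge0_le_integral => //; exact: mphi _ (mI _ Sf).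
  by rewrite integral_cst//= probability_setT mule1.
have J0 f : 0 <= J f by exact: integral_ge0.
have Jfin f : (forall n, S (f n)) -> J f \is a fin_num.
  move=> Sf; rewrite fin_numE gt_eqF ?(lt_le_trans _ (J0 f))//=.
  by rewrite lt_eqF// (le_lt_trans (J2 _ Sf))// ltry.
have Kinf : ereal_inf K \is a fin_num.
  have K0 : 0 <= ereal_inf K by apply: le_ereal_inf_tmp => _ [f _ <-].
  have K2 : ereal_inf K <= 2%:E.
    apply: le_trans (J2 (fun=> Y0) _) => //.
    by apply: ereal_inf_lbound; exists (fun=> Y0).
  rewrite fin_numE gt_eqF ?(lt_le_trans _ K0)//=.
  by rewrite lt_eqF// (le_lt_trans K2)// ltry.
have H1 (k : nat) : exists f,
    (forall n, S (f n)) /\ J f < ereal_inf K + (k.+1%:R^-1)%:E.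
  have [//|_ [f Sf <-] Jf] := @lb_ereal_inf_adherent _ K k.+1%:R^-1 _ Kinf.
  by exists f.
have [fk Hfk] := choice H1.
pose g n := if @unpickle (nat * nat)%type n is Some ij then fk ij.1 ij.2 else Y0.
have Sg n : S (g n).
  by rewrite /g; case: unpickle => // -[i j]; exact: (Hfk i).1.
have Ig k w : I g w <= I (fk k) w.
  apply: le_ereal_inf_tmp => _ [n _ <-]; apply: ereal_inf_lbound.
  by exists (pickle (k, n)) => //; rewrite /g pickleK.
have Jg : J g = ereal_inf K.
  apply/eqP; rewrite eq_le; apply/andP; split; last first.
    by apply: ereal_inf_lbound; exists g.
  apply/lee_addgt0Pr => e e0.
  have [k ke] : exists k : nat, (k.+1%:R^-1 < e)%R.
    have [k _ /(_ k (leqnn k)) H] := near_infty_natSinv_lt (PosNum e0).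
    by exists k.
  apply: (@le_trans _ _ (J (fk k))).
    apply: ge0_le_integral => //.
    - exact: mphi _ (mI _ Sg).
    - exact: mphi _ (mI _ (Hfk k).1).
    - by move=> w _; apply: le_phi; exact: Ig.
  apply: ltW; apply: (lt_trans (Hfk k).2); rewrite lteD2lE// lte_fin.
have leI Y : S Y -> {ae P, forall w, I g w <= Y w}.
  (* Prepending [Y] to the optimal sequence cannot lower the integral further, so the two infima
     agree a.s. and [Y] lies above both. *)
  move=> SY; pose g' n := if n is n'.+1 then g n' else Y.
  have Sg' n : S (g' n) by case: n.
  have Ig' w : I g' w <= I g w.
    apply: le_ereal_inf_tmp => _ [n _ <-]; apply: ereal_inf_lbound.
    by exists n.+1.
  have IgY w : I g' w <= Y w by apply: ereal_inf_lbound; exists 0%N.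
  have Jg' : J g' = J g.
    apply/eqP; rewrite eq_le; apply/andP; split.
      apply: ge0_le_integral => //.
      - exact: mphi _ (mI _ Sg').
      - exact: mphi _ (mI _ Sg).
      - by move=> w _; exact: le_phi.
    by rewrite Jg; apply: ereal_inf_lbound; exists g'.
  have mD : measurable_fun setT (fun w => phi (I g w) - phi (I g' w)).
    by apply: emeasurable_funB; [exact: mphi _ (mI _ Sg)|exact: mphi (mI _ Sg')].
  have D0 w : 0 <= phi (I g w) - phi (I g' w).
    by rewrite sube_ge0//; exact: le_phi.
  have : \int[P]_w `|phi (I g w) - phi (I g' w)| = 0.
    under eq_integral do rewrite gee0_abs//.
    have : J g = \int[P]_w (phi (I g w) - phi (I g' w)) + J g'.
      rewrite -ge0_integralD//; last exact: mphi _ (mI _ Sg').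
      by apply: eq_integral => w _; rewrite subeK.
    rewrite Jg' => /(congr1 (fun x => x - J g)).
    by rewrite addeK ?Jfin// subee ?Jfin.
  move/(ae_eq_integral_abs P measurableT mD); apply: filterS => w /(_ Logic.I) E0.
  rewrite leNgt; apply/negP => lt1.
  have := lt_phi _ _ (le_lt_trans (IgY w) lt1).
  by rewrite -sube_gt0 E0 ltxx.
exists g => //; split => //.
  by apply: measurable_inf_range => n; exact: SG.
move=> Z' _ Z'le.
have /ae_foralln H : forall n, {ae P, forall w, Z' w <= g n w}.
  by move=> n; exact: Z'le.
by apply: filterS H => w Hw; apply: le_ereal_inf_tmp => _ [n _ <-].
Qed.

Lemma essinf_famP (G : set (set Om)) (S : set (Om -> \bar R)) :
  G `<=` measurable -> S !=set0 -> (forall Y, S Y -> gmeasurable G Y) ->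
  is_essinf P G S (essinf_fam P G S).
Proof.
move=> Gm S0 SG; have [f _ fS] := essinf_seq G S Gm S0 SG.
by rewrite /essinf_fam; apply: xgetPex; exists (fun w => ereal_inf (range (f^~ w))).
Qed.

Lemma esssup_famP (G : set (set Om)) (S : set (Om -> \bar R)) :
  G `<=` measurable -> S !=set0 -> (forall Y, S Y -> gmeasurable G Y) ->
  is_esssup P G S (esssup_fam P G S).
Proof.
move=> Gm [Y0 SY0] SG.
pose S' := [set (fun w => - Y w) | Y in S].
have [||f _ [mf fS fglb]] := essinf_seq G S' Gm.
- by exists (fun w => - Y0 w); exists Y0.
- by move=> _ [Y SY <-]; apply: measurableT_comp => //; exact: SG.
rewrite /esssup_fam; apply: xgetPex.
exists (fun w => - ereal_inf (range (f^~ w))); split => //.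
- exact: measurableT_comp.
- move=> Y SY; have : S' (fun w => - Y w) by exists Y.
  by move=> /fS; apply: filterS => w; rewrite leeNr.
- move=> Z' mZ' Z'le; have := fglb (fun w => - Z' w) _ _.
  move=> H; have : {ae P, forall w, - Z' w <= ereal_inf (range (f^~ w))}.
    apply: H; first exact: measurableT_comp.
    by move=> _ [Y SY <-]; apply: filterS (Z'le _ SY) => w; rewrite leeN2.
  by apply: filterS => w; rewrite leeNl.
Qed.

End essential_infimum.

Lemma ae_ex {d} {Om : measurableType d} {R : realType} (P : probability Om R)
    (S : Om -> Prop) : {ae P, forall w, S w} -> exists w, S w.
Proof.
move=> [A [mA A0 SA]]; apply: contrapT => noS.
have /eqP : P [set: Om] = 0%E.
  apply: subset_measure0 mA _ A0 => // w _; apply: SA => Sw.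
  by apply: noS; exists w.
by rewrite probability_setT onee_eq0.
Qed.

Lemma ae_imp {d} {Om : measurableType d} {R : realType} (P : probability Om R)
    (S S' : Om -> Prop) : (forall w, S w -> S' w) ->
  {ae P, forall w, S w} -> {ae P, forall w, S' w}.
Proof. exact: filterS. Qed.

(** * L_p spaces *)

Section Lp_spaces.
Context {d : measure_display} {Om : measurableType d} {R : realType}.
Context (P : probability Om R) (G : set (set Om)).
Hypothesis Gm : G `<=` measurable.
Implicit Types X Y : Om -> R.

Lemma Lp_finP (p : R) X : 0 < p ->
  Lp P G p%:E X <-> gmeasurable G X /\ (\int[P]_w (`|X w| `^ p)%:E < +oo)%E.
Proof.
move=> p0; rewrite /Lp unlock.
have -> : (\int[P]_w (`|(EFin \o X) w| `^ p) = \int[P]_w (`|X w| `^ p)%:E)%E.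
  by apply: eq_integral => w _.
split=> -[mX NX]; split=> //; last exact: poweR_lty.
by apply: lty_poweRy NX; rewrite invr_neq0// gt_eqF.
Qed.

Lemma Lp_scale (p : R) X a : 0 < p -> Lp P G p%:E X ->
  Lp P G p%:E (fun w => a * X w).
Proof.
move=> p0 /(Lp_finP p X p0)[mX iX]; apply/(Lp_finP p _ p0); split.
  exact: measurable_funM.
have mX' : measurable_fun setT X by exact: gmeasurable_measurable mX.
rewrite (eq_integral (fun w => (`|a| `^ p)%:E * (`|X w| `^ p)%:E)%E); last first.
  by move=> w _; rewrite normrM powRM// EFinM.
rewrite ge0_integralZl_EFin ?powR_ge0//.
- by rewrite lte_mul_pinfty ?lee_fin ?powR_ge0.
apply/measurable_EFinP; apply: (measurableT_comp (measurable_powR p)).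
exact: measurableT_comp.
Qed.

Lemma Lp_ooP X : Lp P G +oo%E X <->
  gmeasurable G X /\ exists2 K : R, 0 <= K & {ae P, forall w, `|X w| <= K}.
Proof.
have P0 : (0 < P [set: Om])%E by rewrite probability_setT.
rewrite /Lp unlock P0; split=> -[mX].
  move=> supX; split => //; pose K := ess_sup P (abse \o (EFin \o X)).
  have K0 : (0 <= K)%E by apply: ess_sup_gee => //; apply/nearW => w /=.
  have Kfin : K \is a fin_num by rewrite ge0_fin_numE.
  exists (fine K); first exact: fine_ge0.
  apply: filterS (ess_sup_ge P (abse \o (EFin \o X))) => w.
  by rewrite -[ess_sup _ _](fineK Kfin) /= lee_fin.
move=> [K K0 XK]; split => //; apply: (@le_lt_trans _ _ K%:E); last exact: ltry.
by apply/ess_supP; apply: filterS XK => w; rewrite /= lee_fin.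
Qed.

Lemma Lp_oo_fin (p : R) X : 0 < p -> Lp P G +oo%E X -> Lp P G p%:E X.
Proof.
move=> p0 /Lp_ooP[mX [K K0 XK]]; apply/Lp_finP => //; split => //.
have mX' : measurable_fun setT X by exact: gmeasurable_measurable mX.
apply: (@le_lt_trans _ _ (\int[P]_w (cst (K `^ p)%:E w))%E); last first.
  by rewrite integral_cst//= probability_setT mule1 ltry.
apply: ae_ge0_le_integral => //.
- apply/measurable_EFinP; apply: (measurableT_comp (measurable_powR p)).
  exact: measurableT_comp.
- by move=> w _; rewrite lee_fin powR_ge0.
- apply: filterS XK => w XK _; rewrite lee_fin.
  by apply: ge0_ler_powR => //; rewrite ?nnegrE ?ltW.
Qed.

End Lp_spaces.

(** * Null sets and expectations under the measures of [calQ] *)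

Section price.
Context {R : realType} {d : measure_display} {Om : measurableType d}.
Context {P : probability Om R} {T : R} (hT : 0 < T).
Context {F : R -> set (set Om)} (hF : complete_filtration P T F).
Context (hF0 : trivial_sigma P (F 0)) {p : R} (hp : 1 <= p).
Context {rho : R -> R -> (Om -> R) -> (Om -> R)}.
Context (hrho : convex_risk_measure P T F p rho).
Context (hdom : dominated P T F p rho) (hsens : sensitive P T F p rho).

Local Notation OT := (g_sigma_algebraType (F T)).
Local Notation calQ := (@calQ _ _ _ P T F p rho).
Local Notation c := (cnorm P T F p rho).
Implicit Types (X Y Z : Om -> R) (Q : probability OT R).

Let T0 : 0 <= (0 : R) <= T. Proof. by rewrite lexx ltW. Qed.
Let TT : 0 <= T <= T. Proof. by rewrite lexx ltW. Qed.
Let p0 : 0 < p. Proof. exact: lt_le_trans hp. Qed.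

Lemma filtration_sigma t : 0 <= t <= T -> sigma_algebra setT (F t).
Proof. by case: hF => H _ _ /H[]. Qed.

Lemma filtration_measurable t : 0 <= t <= T -> F t `<=` measurable.
Proof. by case: hF => H _ _ /H[]. Qed.

Lemma filtration_sub s t : 0 <= s -> s <= t -> t <= T -> F s `<=` F t.
Proof. by case: hF => _ H _; exact: H. Qed.

Lemma filtration_null N t : 0 <= t <= T -> P.-negligible N -> F t N.
Proof.
case: hF => _ _ H /andP[t0 tT] /H; exact: filtration_sub.
Qed.

Lemma filtrationC t A : 0 <= t <= T -> F t A -> F t (~` A).
Proof. by move=> /filtration_sigma[_ + _] => /[apply]; rewrite setTD. Qed.

Lemma filtrationT t : 0 <= t <= T -> F t setT.
Proof.
by move=> tT; rewrite -setC0; apply: filtrationC => //; case: (filtration_sigma t tT).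
Qed.

(** [Q] lives on [F T] and [P] on the ambient sigma-algebra. Completeness bridges the two: every
    [P]-negligible set belongs to [F T], where equivalence of [Q] and [P] applies. *)
Lemma calQ_ae {Q} {S : Om -> Prop} : calQ Q ->
  {ae P, forall w, S w} <-> {ae Q, forall w, S w}.
Proof.
move=> [QP _]; split=> -[A [mA A0 SA]].
  have nN : P.-negligible (~` [set w | S w]) by exists A.
  exists (~` [set w | S w]); split => //.
    by apply: gmeasurable_set; [exact: filtration_sigma|exact: filtration_null].
  apply/QP; first exact: filtration_null.
  apply/negligibleP => //.
  by apply: (filtration_measurable T) => //; exact: filtration_null.
have FA : F T A by rewrite -(sigma_algebra_id (filtration_sigma T TT)).
exists A; split => //; last exact/QP.
exact: filtration_measurable FA.
Qed.

Lemma gmeasurable_T t {d'} {U : measurableType d'} (X : Om -> U) :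
  0 <= t <= T -> gmeasurable (F t) X -> gmeasurable (F T) X.
Proof.
move=> /andP[t0 tT]; apply: gmeasurable_sub.
exact: filtration_sub.
Qed.

Lemma gmeasurable_ambient t {d'} {U : measurableType d'} (X : Om -> U) :
  0 <= t <= T -> gmeasurable (F t) X -> measurable_fun (setT : set Om) X.
Proof.
move=> tT; apply: gmeasurable_measurable.
exact: filtration_measurable.
Qed.

(** Events of [F 0] have [P]-probability 0 or 1, hence the same [Q]-probability, so the constant
    expectation, possibly infinite, integrates correctly over each of them. *)
Lemma trivial_condexp Q (X : Om -> \bar R) : calQ Q ->
  gmeasurable (F T) X -> (forall w, 0 <= X w)%E ->
  is_condexp_ge0 Q (F 0) X (cst (\int[Q]_w X w))%E.
Proof.
move=> QQ mX X0; have [QP _] := QQ; split => //.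
- exact: measurable_cst.
- by move=> w; exact: integral_ge0.
move=> A FA.
have FTA : F T A by apply: filtration_sub FA => //; exact: ltW.
have mA : measurable (A : set OT).
  by apply: gmeasurable_set => //; exact: filtration_sigma.
have mX' : measurable_fun (setT : set OT) X by [].
rewrite integral_cst//=.
have [PA|PA] := hF0 A FA.
  have QA : Q A = 0%E by exact/QP.
  rewrite QA mule0 null_set_integral//; first exact: measurable_funTS.
have QA : Q (~` A) = 0%E.
  apply/QP; first exact: filtrationC.
  by rewrite probability_setC ?PA ?subee//; exact: filtration_measurable FTA.
rewrite (@ge0_negligible_integral _ _ _ Q setT (~` A))//; last exact: measurableC.
rewrite setTD setCK.
suff -> : Q A = 1%E by rewrite mule1.
by rewrite -(setCK A) probability_setC ?QA ?sube0//; exact: measurableC.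
Qed.

Lemma rho_gmeasurable s t X : 0 <= s -> s <= t -> t <= T ->
  Lp P (F t) p%:E X -> gmeasurable (F s) (rho s t X).
Proof. by move=> s0 st tT; have [H _ _ _] := hrho s t s0 st tT => /H[]. Qed.

Lemma penalty_ge Q X C : calQ Q -> Lp P (F T) p%:E X ->
  is_condexp Q (F 0) (fun w => (- X w)%:E) C ->
  {ae P, forall w, C w - (rho 0 T X w)%:E <= min_penalty P p rho 0 T Q w}%E.
Proof.
move=> QQ LX XC.
have [//||_ + _] := @esssup_famP _ _ _ P (F 0)
  [set Z | exists X C, [/\ Lp P (F T) p%:E X,
    is_condexp Q (F 0) (fun w => (- X w)%:E) C
    & Z = (fun w => (C w - (rho 0 T X w)%:E)%E)]] (filtration_measurable _ T0).
- by eexists; exists X, C.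
- move=> _ [X' [C' [LX' [Zp [Zn [[mp _ _] [mn _ _] ->]]] ->]]].
  apply: emeasurable_funB; first exact: emeasurable_funB.
  by apply/measurable_EFinP; apply: rho_gmeasurable => //; exact: ltW.
by apply; exists X, C.
Qed.

(** A scaling argument: testing the penalty at [- n X] and using homogeneity of [rhobar], the number
    [n (E_Q X - rhobar (- X))] stays below the finite penalty plus [rho 0 T 0] for every [n], so the
    bracket cannot be positive. *)
Lemma calQ_le_coherent Q rhobar X : calQ Q ->
  coherent_risk_measure P T F p rhobar ->
  (forall X, Lp P (F T) p%:E X ->
     {ae P, forall w, rho 0 T X w - rho 0 T (cst 0) w <= rhobar X}) ->
  Lp P (F T) p%:E X -> (forall w, 0 <= X w) ->
  (\int[Q]_w (X w)%:E <= (rhobar (fun w => - X w)%R)%:E)%E.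
Proof.
move=> QQ [_ _ hom _] dom LX X0.
set e := (\int[Q]_w (X w)%:E)%E.
pose Y (n : nat) w := n%:R * (- X w).
have LNX : Lp P (F T) p%:E (fun w => - X w).
  have := @Lp_scale _ _ _ P (F T) (filtration_measurable _ TT) p X (-1) p0 LX.
  rewrite (_ : (fun w => -1 * X w) = (fun w => - X w))//.
  by apply/funext => w; rewrite mulN1r.
have LY n : Lp P (F T) p%:E (Y n).
  by apply: Lp_scale => //; exact: filtration_measurable.
have mX : measurable_fun (setT : set OT) X by case: LX.
have CY n : is_condexp Q (F 0) (fun w => (- Y n w)%:E) (cst (n%:R%:E * e)%E).
  have E : (fun w => (- Y n w)%:E) = (fun w => (n%:R%:E * (X w)%:E)%E).
    by apply/funext => w; rewrite /Y mulrN opprK EFinM.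
  have Y0 w : (0 <= n%:R%:E * (X w)%:E)%E by rewrite lee_fin mulr_ge0.
  have mnX : measurable_fun (setT : set OT) (fun w => (n%:R%:E * (X w)%:E)%E).
    by apply: measurable_funeM; exact/measurable_EFinP.
  exists (cst (n%:R%:E * e)%E), (cst 0%E); split.
  - have -> : (fun w => (- Y n w)%:E)^\+%E = (fun w => (n%:R%:E * (X w)%:E)%E).
      by rewrite E; apply/funext => w; apply: (@ge0_funeposE _ _ setT); rewrite ?inE.
    have := @trivial_condexp Q (fun w => (n%:R%:E * (X w)%:E)%E) QQ mnX Y0.
    rewrite ge0_integralZl_EFin//; first by move=> w _; rewrite lee_fin.
    exact/measurable_EFinP.
  - have -> : (fun w => (- Y n w)%:E)^\-%E = cst 0%E.
      by rewrite E; apply/funext => w; apply: (@ge0_funenegE _ _ setT); rewrite ?inE.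
    have := @trivial_condexp Q (cst 0%E) QQ (measurable_cst _) (fun=> lexx _).
    by rewrite integral0.
  - by apply/funext => w /=; rewrite sube0.
have : {ae P, forall w, e <= (rhobar (fun w => - X w)%R)%:E}%E.
  have [_ finpen] := QQ.
  have /ae_foralln H1 := fun n => penalty_ge Q (Y n) _ QQ (LY n) (CY n).
  have /ae_foralln H2 := fun n => dom (Y n) (LY n).
  near=> w.
  have h0 : (min_penalty P p rho 0 T Q w < +oo)%E by near: w.
  have h1 n : (n%:R%:E * e - (rho 0 T (Y n) w)%:E <= min_penalty P p rho 0 T Q w)%E.
    by move: n; near: w.
  have h2 n : rho 0 T (Y n) w - rho 0 T (cst 0) w <= n%:R * rhobar (fun w => - X w).
    by rewrite -hom//; move: n; near: w.
  have e0 : (0 <= e)%E by apply: integral_ge0 => v _; rewrite lee_fin.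
  (* The instance [n = 0] rules out the penalty [-oo], and below [n = 1] rules out an infinite
     expectation of [X]. *)
  move: (min_penalty P p rho 0 T Q w) h0 h1 => [a| |]// _ h1; last first.
    have := h1 0%N; rewrite mul0e sub0e => /=; by rewrite leeNy_eq.
  have : (e < +oo)%E.
    by rewrite ltey; apply/eqP => ee; have := h1 1%N; rewrite ee mul1e.
  rewrite -ge0_fin_numE// => efin.
  rewrite -(fineK efin) lee_fin leNgt; apply/negP => lte.
  have h n : n%:R * (fine e - rhobar (fun w => - X w)) <= a + rho 0 T (cst 0) w.
    have := h1 n; rewrite -(fineK efin) -EFinM -EFinB lee_fin => h1n.
    by have := h2 n; lra.
  have := lte; rewrite -subr_gt0 => d0.
  have := h (Num.bound
    `|(a + rho 0 T (cst 0) w) / (fine e - rhobar (fun w => - X w))|).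
  apply/negP; rewrite -ltNge -ltr_pdivrMr//.
  exact: le_lt_trans (ler_norm _) (archi_boundP (normr_ge0 _)).
by move=> /ae_ex[].
Unshelve. all: end_near.
Qed.

(** * The norm c and the space L^c *)

Lemma cnorm_ge0 X : (0 <= c X)%E.
Proof.
have [Q QQ] := hsens; apply: le_trans (ereal_sup_ubound _); last by exists Q.
exact: integral_ge0.
Qed.

Lemma integral_le_cnorm Q X : calQ Q -> (\int[Q]_w `|(X w)%:E| <= c X)%E.
Proof. by move=> QQ; apply: ereal_sup_ubound; exists Q. Qed.

Lemma cnorm_le X K :
  (forall Q, calQ Q -> \int[Q]_w `|(X w)%:E| <= K)%E -> (c X <= K)%E.
Proof. by move=> H; apply: ge_ereal_sup => _ [Q /H + <-]. Qed.

(** Monotonicity and the triangle inequality in one, since most estimates below split a variable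
    pointwise into two pieces. *)
Lemma le_cnormD X Y Z : gmeasurable (F T) X -> gmeasurable (F T) Y ->
  gmeasurable (F T) Z -> {ae P, forall w, `|X w| <= `|Y w| + `|Z w|} ->
  (c X <= c Y + c Z)%E.
Proof.
move=> mX mY mZ XYZ; apply: cnorm_le => Q QQ.
have mabs (V : Om -> R) : gmeasurable (F T) V ->
    measurable_fun (setT : set OT) (fun w => `|(V w)%:E|)%E.
  by move=> mV; apply: measurableT_comp => //; exact/measurable_EFinP.
apply: (@le_trans _ _ (\int[Q]_w (`|(Y w)%:E| + `|(Z w)%:E|))%E).
  apply: ae_ge0_le_integral => //; first exact: mabs.
    by move=> w _; exact: adde_ge0.
    by apply: emeasurable_funD; exact: mabs.
  apply/(calQ_ae QQ); apply: filterS XYZ => w /= XYZ _.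
  by rewrite lee_fin.
rewrite ge0_integralD//; [|exact: mabs|exact: mabs].
by apply: leeD; exact: integral_le_cnorm.
Qed.

Lemma cnorm_cst (K : R) : 0 <= K -> (c (cst K) <= K%:E)%E.
Proof.
move=> K0; apply: cnorm_le => Q QQ.
rewrite (_ : (fun w => _) = cst K%:E).
  by rewrite integral_cst//= probability_setT mule1.
by apply/funext => w /=; rewrite ger0_norm.
Qed.

Lemma cnorm0 : c (cst 0) = 0%E.
Proof. by apply/eqP; rewrite eq_le cnorm_ge0 (le_trans (cnorm_cst 0 _)). Qed.

Lemma le_cnorm X Y : gmeasurable (F T) X -> gmeasurable (F T) Y ->
  {ae P, forall w, `|X w| <= `|Y w|} -> (c X <= c Y)%E.
Proof.
move=> mX mY XY; rewrite -[leRHS]adde0 -cnorm0; apply: le_cnormD => //.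
  exact: measurable_cst.
by apply: filterS XY => w; rewrite normr0 addr0.
Qed.

(** Sensitivity provides one [Q] in [calQ]; its [L_1]-norm is below [c], and its null sets are those
    of [P]. *)
Lemma cnorm_eq0 X : gmeasurable (F T) X ->
  (forall e : R, 0 < e -> (c X <= e%:E)%E) -> {ae P, forall w, X w = 0}.
Proof.
move=> mX cX; have [Q QQ] := hsens.
have mX' : measurable_fun (setT : set OT) (EFin \o X) by exact/measurable_EFinP.
have : (\int[Q]_w `|(EFin \o X) w| = 0)%E.
  apply/eqP; rewrite eq_le integral_ge0// andbT.
  apply/lee_addgt0Pr => e e0; rewrite add0e.
  exact: le_trans (integral_le_cnorm _ _ QQ) (cX e e0).
move=> /(ae_eq_integral_abs Q measurableT mX') /(calQ_ae QQ) H.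
by apply: ae_imp H => w /(_ Logic.I) [].
Qed.

(* If the indicators of small events were not uniformly small for [c], then
   some [X] in [L_p] would dominate a.s. [n 1_(A n)] for events [A n] with
   [c (1_(A n)) > e], contradicting [n Q (A n) <= E_Q X <= rhobar (- X)]. *)
Lemma cnorm_indic_small (e : R) : 0 < e ->
  exists2 dl : R, 0 < dl &
    forall A, F T A -> (P A <= dl%:E)%E -> (c \1_A <= e%:E)%E.
Proof.
move=> e0; apply: contrapT => noH.
(* Chosen so that [(n+1)^p P(A n) <= 2^-(n+1)]: the series [W] of the [(n+1)^p 1_(A n)] then has
   [P]-expectation at most 1. *)
pose dl (n : nat) : R := (1 / (2 ^ n.+1)%:R) / (n.+1%:R `^ p).
have np n : 0 < n.+1%:R `^ p by rewrite powR_gt0// ltr0n.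
have dl0 n : 0 < dl n.
  by rewrite divr_gt0// divr_gt0// ltr0n expn_gt0.
have H n : exists A, [/\ F T A, (P A <= (dl n)%:E)%E & (e%:E < c \1_A)%E].
  apply: contrapT => H; apply: noH; exists (dl n) => // A FA PA.
  by rewrite leNgt; apply/negP => eA; apply: H; exists A.
have [A HA] := choice H.
have mAT n : measurable (A n : set OT).
  by apply: gmeasurable_set; [exact: filtration_sigma|have [] := HA n].
have mA n : measurable (A n : set Om).
  by apply: (filtration_measurable T) => //; have [] := HA n.
pose f (n : nat) (w : Om) := (n.+1%:R `^ p * \1_(A n) w)%:E.
have f0 n w : (0 <= f n w)%E by rewrite lee_fin mulr_ge0// powR_ge0.
pose W w := (\sum_(n <oo) f n w)%E.
have mf n : measurable_fun (setT : set OT) (f n).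
  apply/measurable_EFinP; apply: measurable_funM => //.
have mW : gmeasurable (F T) W.
  by apply: ge0_emeasurable_sum => // k w _ _; exact: f0.
have mWP : measurable_fun (setT : set Om) W by exact: gmeasurable_ambient mW.
have W0 w : (0 <= W w)%E by apply: nneseries_ge0 => n _ _; exact: f0.
have iW : (\int[P]_w W w <= 1)%E.
  rewrite integral_nneseries//; last first.
    by move=> n; apply: (gmeasurable_ambient T) => //; exact: mf.
  apply: le_trans (@epsilon_trick0 R 1 xpredT ler01).
  apply: lee_nneseries => [n _ _|n _]; first exact: integral_ge0.
  rewrite /f; under eq_integral do rewrite EFinM.
  rewrite ge0_integralZl_EFin ?powR_ge0//; last first.
  - by apply/measurable_EFinP; exact: measurable_indic.
  rewrite integral_indic// setIT.
  have [_ PA _] := HA n; rewrite /dl in PA.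
  rewrite (_ : (1 / _)%:E = ((n.+1%:R `^ p)%:E * (dl n)%:E)%E).
    by apply: lee_wpmul2l => //; rewrite lee_fin powR_ge0.
  by rewrite -EFinM /dl mulrCA mulfV ?mulr1// gt_eqF.
have Wfin : {ae P, forall w, W w \is a fin_num}.
  have iW' : P.-integrable [set: Om] W.
    apply/integrableP; split => //; under eq_integral do rewrite gee0_abs//.
    by rewrite (le_lt_trans iW)// ltry.
  by apply: filterS (integrable_ae measurableT iW') => w; apply.
(* The [p]-th root puts [X] in [L_p], and on [A n] the single term of index [n] in the series
   already gives [X >= n+1]. *)
pose X w := fine (W w) `^ p^-1.
have X0 w : 0 <= X w by exact: powR_ge0.
have LX : Lp P (F T) p%:E X.
  apply/Lp_finP => //.
  split.
    apply: (measurableT_comp (measurable_powR _)).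
    exact: measurableT_comp mW.
  apply: le_lt_trans (ltry 1); apply: le_trans iW.
  apply: ge0_le_integral => //.
  - apply/measurable_EFinP; apply: (measurableT_comp (measurable_powR _)).
    apply: measurableT_comp => //; apply: (measurableT_comp (measurable_powR _)).
    exact: measurableT_comp mWP.
  - move=> w _; rewrite ger0_norm// /X -powRrM mulVf ?gt_eqF// powRr1 ?fine_ge0//.
    move: (W0 w); case: (W w) => //= r _; rewrite ?leey ?lexx//.
have [rhobar coh dom] := hdom.
have le n : n.+1%:R * e <= rhobar (fun w => - X w).
  rewrite -ler_pdivlMl ?ltr0n//.
  have [_ _ eA] := HA n.
  rewrite -lee_fin; apply/ltW; apply: (lt_le_trans eA).
  apply: cnorm_le => Q QQ.
  have QX := calQ_le_coherent Q rhobar X QQ coh dom LX X0.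
  have nX : {ae Q, forall w, [set: OT] w ->
      (n.+1%:R%:E * (\1_(A n) w)%:E <= (X w)%:E)%E}.
    apply/(calQ_ae QQ); apply: filterS Wfin => w Wfin _.
    rewrite -EFinM lee_fin indicE.
    have [wA|_] := boolP (w \in A n); last by rewrite mulr0.
    have {1}-> : n.+1%:R = (n.+1%:R `^ p) `^ p^-1 :> R.
      by rewrite -powRrM mulfV ?gt_eqF// powRr1.
    rewrite mulr1.
    apply: ge0_ler_powR; rewrite ?invr_ge0 ?nnegrE ?powR_ge0 ?fine_ge0 ?(ltW p0)//.
    rewrite -lee_fin fineK//.
    apply: le_trans (nneseries_lim_ge n.+1 _); last by move=> k _ _; exact: f0.
    rewrite big_nat_recr//= -[leLHS]add0e leeD//; first exact: sume_ge0.
    by rewrite /f indicE wA mulr1.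
  have mI : measurable_fun (setT : set OT) (fun w => (\1_(A n) w : R)%:E).
    by apply/measurable_EFinP; exact: measurable_indic.
  have : (\int[Q]_w (n.+1%:R%:E * (\1_(A n) w)%:E) <= \int[Q]_w (X w)%:E)%E.
    apply: ae_ge0_le_integral => //.
    - by apply: measurable_funeM.
    - by move=> w _; rewrite lee_fin.
    - by apply/measurable_EFinP; case: LX.
  rewrite ge0_integralZl_EFin// => /le_trans /(_ QX).
  under [X in _ -> (X <= _)%E]eq_integral do rewrite gee0_abs ?lee_fin//.
  by rewrite EFinM lee_pdivlMl ?ltr0n.
have := archi_boundP (normr_ge0 (rhobar (fun w => - X w) / e)).
set N := Num.bound _ => /(le_lt_trans (ler_norm _)); rewrite ltr_pdivrMr//.
apply/negP; rewrite -leNgt; apply: le_trans (le N).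
by rewrite ler_pM2r// ler_nat.
Qed.

Lemma filtration_lt t X Y : 0 <= t <= T -> gmeasurable (F t) X ->
  gmeasurable (F t) Y -> F t [set w | X w < Y w].
Proof.
move=> tT mX mY.
have mlt : gmeasurable (F t) (fun w => X w < Y w) by exact: measurable_fun_ltr.
rewrite (_ : [set w | X w < Y w] = (fun w => X w < Y w) @^-1` [set true]).
  by apply: gmeasurable_preimage => //; exact: filtration_sigma.
by apply/seteqP; split.
Qed.

Lemma gmeasurable_indic t A : 0 <= t <= T -> F t A ->
  gmeasurable (F t) (\1_A : Om -> R).
Proof.
move=> tT FA; apply: measurable_indic; apply: gmeasurable_set => //.
exact: filtration_sigma.
Qed.

Lemma cnormZ K X : 0 <= K -> gmeasurable (F T) X ->
  (c (fun w => K * X w)%R <= K%:E * c X)%E.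
Proof.
move=> K0 mX; apply: cnorm_le => Q QQ.
rewrite (eq_integral (fun w : OT => K%:E * `|(X w)%:E|)%E); last first.
  by move=> w _; rewrite EFinM abseM gee0_abs.
rewrite ge0_integralZl_EFin//; last first.
  by apply: measurableT_comp => //; exact/measurable_EFinP.
by rewrite lee_wpmul2l ?lee_fin//; exact: integral_le_cnorm.
Qed.

Lemma probability_cvg0 (A : nat -> set Om) :
  (forall n, measurable (A n)) ->
  {ae P, forall w, exists N, forall n, (N <= n)%N -> ~ A n w} ->
  forall dl : R, 0 < dl -> exists N, forall n, (N <= n)%N -> (P (A n) <= dl%:E)%E.
Proof.
move=> mA Aae dl dl0.
have [|||||_ _ +] := @dominated_convergence _ _ _ P setT measurableT
  (fun n w => (\1_(A n) w)%:E) (cst 0%E) (cst 1%E).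
- by move=> n; apply/measurable_EFinP; exact: measurable_indic.
- exact: measurable_cst.
- apply: filterS Aae => w [N HN] _; apply: cvg_near_cst.
  by exists N => // n /= /HN An; rewrite indicE memNset.
- exact: finite_measure_integrable_cst.
- by apply/nearW => w n _; rewrite /= lee_fin indicE ger0_norm// lern1 leq_b1.
rewrite integral0 => /fine_cvgP[fin /cvgrPdist_le /(_ dl dl0)[N _ HN]].
exists N => n Nn; have := HN n Nn; rewrite /= integral_indic// setIT sub0r normrN.
move=> H; rewrite -[P (A n)]fineK; last exact: fin_num_measure.
by rewrite lee_fin; apply: le_trans (ler_norm _) H.
Qed.

Lemma Lc_gmeasurable t X : Lc P T F p rho t X -> gmeasurable (F t) X.
Proof. by case. Qed.

(** Uniform integrability over [calQ]: up to a small [c]-error [Y] is a variable bounded by [K], and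
    the indicator of [|Y| > n] is small for [c] because its [P]-probability tends to 0. *)
Lemma cnorm_tail t Y : 0 <= t <= T -> Lc P T F p rho t Y ->
  forall e : R, 0 < e -> exists N, forall n, (N <= n)%N ->
  (c (fun w => \1_[set v | n%:R < `|Y v|] w * Y w)%R <= e%:E)%E.
Proof.
move=> tT [mY LY] e e0.
have e2 : 0 < e / 2 by rewrite divr_gt0.
have [B LB YB] := LY _ e2.
have [mB [K K0 BK]] := (Lp_ooP P (F t) B).1 LB.
have K1 : 0 < K + 1 by rewrite ltr_pwDr.
(* [K] may be 0; [K + 1] keeps the divisor positive and is the coefficient given to the indicator
   below. *)
have [dl dl0 Hdl] := @cnorm_indic_small (e / 2 / (K + 1)) (divr_gt0 e2 K1).
have mYT := gmeasurable_T t _ tT mY.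
have mBT := gmeasurable_T t _ tT mB.
have FA (n : nat) : F T [set v | n%:R < `|Y v|].
  apply: filtration_lt => //; first exact: measurable_cst.
  exact: measurableT_comp.
have [||N HN] := @probability_cvg0 (fun n => [set v | n%:R < `|Y v|]) _ _ dl dl0.
- by move=> n; apply: (filtration_measurable T) => //; exact: FA.
- apply/nearW => w; exists (Num.bound `|Y w|) => n nN /=.
  apply/negP; rewrite -leNgt; apply: (le_trans (ltW (archi_boundP (normr_ge0 _)))).
  by rewrite ler_nat.
exists N => n nN; set A := [set v | _].
have mA : gmeasurable (F T) (\1_A : Om -> R) by exact: gmeasurable_indic TT (FA n).
have cA : (c \1_A <= (e / 2 / (K + 1))%:E)%E by apply: Hdl; [exact: FA|exact: HN].
apply: (@le_trans _ _ (c (fun w => Y w - B w)%R + c (fun w => (K + 1) * \1_A w)%R)%E).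
  apply: le_cnormD.
  - exact: measurable_funM.
  - exact: measurable_funB.
  - by apply: measurable_funM => //; exact: measurable_cst.
  - apply: filterS BK => w BK.
    have [wA|wA] := pselect (A w); last first.
      by rewrite indicE memNset// mul0r normr0 addr_ge0.
    rewrite indicE mem_set// mul1r mulr1 (ger0_norm (ltW K1)).
    rewrite -{1}(subrK (B w) (Y w)); apply: (le_trans (ler_normD _ _)).
    by rewrite lerD2l; lra.
rewrite [e in leRHS]splitr EFinD; apply: leeD => //.
apply: (le_trans (cnormZ _ _ (ltW K1) mA)).
apply: (@le_trans _ _ ((K + 1)%:E * (e / 2 / (K + 1))%:E)%E).
  by apply: lee_wpmul2l => //; rewrite lee_fin ltW.
by rewrite -EFinM mulrC mulfVK// gt_eqF.
Qed.

Definition trunc (n : nat) X : Om -> R :=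
  fun w => Num.max (- n%:R) (Num.min n%:R (X w)).

Lemma trunc_bound n X w : `|trunc n X w| <= n%:R.
Proof.
have n0 : 0 <= n%:R :> R by [].
rewrite /trunc ler_norml le_max lexx /= ge_max ge_min lexx /= andbT; lra.
Qed.

Lemma trunc_dist n (x y : R) : `|x| <= `|y| ->
  `|x - Num.max (- n%:R) (Num.min n%:R x)| <= (if n%:R < `|y| then `|y| else 0).
Proof.
move=> xy; have n0 : 0 <= n%:R :> R by [].
case: ltP => yn.
  apply: le_trans xy; case: (leP n%:R x) => nx.
    by rewrite max_r; [rewrite ger0_norm ?ger0_norm; lra|lra].
  case: (leP (- n%:R) x) => nx'; first by rewrite subrr normr0.
  by rewrite ler0_norm ?ler0_norm; lra.
have := le_trans xy yn; rewrite ler_norml => /andP[h1 h2].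
by rewrite min_r// max_r// subrr normr0.
Qed.

Lemma trunc_le n (x y : R) : x <= y ->
  Num.max (- n%:R) (Num.min n%:R x) <= Num.max (- n%:R) (Num.min n%:R y).
Proof.
move=> xy; rewrite ge_max le_max lexx /= le_max orbC.
by rewrite le_min !ge_min lexx xy /= orbT.
Qed.

Lemma gmeasurable_trunc G n X : gmeasurable G X -> gmeasurable G (trunc n X).
Proof.
move=> mX; apply: measurable_maxr; first exact: measurable_cst.
by apply: measurable_minr => //; exact: measurable_cst.
Qed.

Lemma trunc_Lp t n X : 0 <= t <= T -> gmeasurable (F t) X ->
  Lp P (F t) +oo%E (trunc n X).
Proof.
move=> tT mX; apply/Lp_ooP; split; first exact: gmeasurable_trunc.
by exists n%:R => //; apply/nearW => w; exact: trunc_bound.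
Qed.

(** Where [|Y| <= n] truncation leaves [Z] unchanged, and elsewhere the error is at most [|Y|]; so
    the tails of the majorant control it, without prior knowledge that [Z] is in [L^c]. *)
Lemma trunc_cvg t Z Y : 0 <= t <= T -> Lc P T F p rho t Y ->
  gmeasurable (F t) Z -> {ae P, forall w, `|Z w| <= `|Y w|} ->
  forall e : R, 0 < e -> exists N, forall n, (N <= n)%N ->
  (c (fun w => Z w - trunc n Z w)%R <= e%:E)%E.
Proof.
move=> tT LY mZ ZY e e0; have [N HN] := cnorm_tail t Y tT LY e e0.
have mYT := gmeasurable_T t _ tT (Lc_gmeasurable _ _ LY).
have mZT := gmeasurable_T t _ tT mZ.
exists N => n /HN; apply: le_trans; apply: le_cnorm.
- by apply: measurable_funB => //; exact: gmeasurable_trunc.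
- apply: measurable_funM => //; apply: gmeasurable_indic => //.
  apply: filtration_lt => //; first exact: measurable_cst.
  exact: measurableT_comp.
- apply: filterS ZY => w ZY; apply: (le_trans (trunc_dist n _ _ ZY)).
  case: ifPn => h; last exact: normr_ge0.
  by rewrite indicE mem_set//= mul1r.
Qed.

Lemma Lc_solid t Z Y : 0 <= t <= T -> Lc P T F p rho t Y ->
  gmeasurable (F t) Z -> {ae P, forall w, `|Z w| <= `|Y w|} ->
  Lc P T F p rho t Z.
Proof.
move=> tT LY mZ ZY; split => // e e0.
have [N HN] := trunc_cvg t Z Y tT LY mZ ZY e e0.
by exists (trunc N Z); [exact: trunc_Lp|exact: HN].
Qed.

Lemma Lp_ooB G X Y : Lp P G +oo%E X -> Lp P G +oo%E Y ->
  Lp P G +oo%E (fun w => X w - Y w).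
Proof.
move=> /Lp_ooP[mX [K K0 XK]] /Lp_ooP[mY [L L0 YL]]; apply/Lp_ooP.
split; first exact: measurable_funB.
exists (K + L); first exact: addr_ge0.
apply: filterS2 XK YL => w XK YL.
by apply: (le_trans (ler_normB _ _)); exact: lerD.
Qed.

Lemma Lp_oo_Lc t X : Lp P (F t) +oo%E X -> Lc P T F p rho t X.
Proof.
move=> LX; split; first by case: LX.
move=> e e0; exists X => //.
rewrite (_ : (fun w => _) = cst 0); last by apply/funext => w; rewrite subrr.
by rewrite cnorm0 lee_fin ltW.
Qed.

Lemma LcB t X Y : 0 <= t <= T -> Lc P T F p rho t X -> Lc P T F p rho t Y ->
  Lc P T F p rho t (fun w => X w - Y w).
Proof.
move=> tT [mX LX] [mY LY]; split; first exact: measurable_funB.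
move=> e e0; have e2 : 0 < e / 2 by rewrite divr_gt0.
have [B LB XB] := LX _ e2; have [B' LB' YB] := LY _ e2.
exists (fun w => B w - B' w); first exact: Lp_ooB.
rewrite [e]splitr EFinD; apply: le_trans (leeD XB YB).
have [[mB _] [mB' _]] := (LB, LB').
apply: le_cnormD; [| | |apply/nearW => w].
- by apply: (gmeasurable_T t) => //; do 2 apply: measurable_funB => //.
- by apply: (gmeasurable_T t) => //; apply: measurable_funB.
- by apply: (gmeasurable_T t) => //; apply: measurable_funB.
rewrite (_ : _ - _ = (X w - B w) - (Y w - B' w)); first exact: ler_normB.
by ring.
Qed.

Lemma cnorm_Lc_fin t X : 0 <= t <= T -> Lc P T F p rho t X -> (c X < +oo)%E.
Proof.
move=> tT [mX LX]; have [B LB XB] := LX 1 ltr01.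
have [mB [K K0 BK]] := (Lp_ooP P (F t) B).1 LB.
apply: (@le_lt_trans _ _ (1%:E + K%:E)%E); last by rewrite -EFinD ltry.
apply: le_trans (leeD XB (cnorm_cst K K0)).
apply: le_cnormD.
- exact: (gmeasurable_T t).
- by apply: (gmeasurable_T t) => //; apply: measurable_funB.
- exact: measurable_cst.
- apply: filterS BK => w BK; rewrite -{1}(subrK (B w) (X w)).
  by apply: (le_trans (ler_normD _ _)); rewrite lerD2l /= (ger0_norm K0).
Qed.

Lemma cnorm_dominated_cvg t (X_ : nat -> Om -> R) Y : 0 <= t <= T ->
  Lc P T F p rho t Y -> (forall n, gmeasurable (F t) (X_ n)) ->
  (forall n, {ae P, forall w, `|X_ n w| <= `|Y w|}) ->
  {ae P, forall w, X_ n w @[n --> \oo] --> 0} ->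
  forall e : R, 0 < e -> exists N, forall n, (N <= n)%N -> (c (X_ n) <= e%:E)%E.
Proof.
move=> tT LY mX XY X0 e e0.
have e3 : 0 < e / 3 by rewrite divr_gt0.
have [M /(_ M (leqnn M)) HM] := cnorm_tail t Y tT LY _ e3.
have mYT := gmeasurable_T t _ tT (Lc_gmeasurable _ _ LY).
have mXT n := gmeasurable_T t _ tT (mX n).
have M1 : 0 < M%:R + 1 :> R by rewrite ltr_pwDr.
have [dl dl0 Hdl] := @cnorm_indic_small (e / 3 / (M%:R + 1)) (divr_gt0 e3 M1).
have FA (n : nat) : F T [set v | e / 3 < `|X_ n v|].
  apply: filtration_lt => //; first exact: measurable_cst.
  exact: (measurableT_comp _ (mXT n)).
have FB : F T [set v | M%:R < `|Y v|].
  apply: filtration_lt => //; first exact: measurable_cst.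
  exact: measurableT_comp.
have [||N HN] := @probability_cvg0 (fun n => [set v | e / 3 < `|X_ n v|]) _ _ dl dl0.
- by move=> n; apply: (filtration_measurable T) => //; exact: FA.
- apply: filterS X0 => w /cvgrPdist_le /(_ _ e3)[N _ HN]; exists N => n Nn /=.
  by apply/negP; rewrite -leNgt; have := HN n Nn; rewrite sub0r normrN.
exists N => n nN; pose A := [set v | e / 3 < `|X_ n v|].
have mA : gmeasurable (F T) (\1_A : Om -> R) by exact: gmeasurable_indic TT (FA n).
have cA : (c \1_A <= (e / 3 / (M%:R + 1))%:E)%E by apply: Hdl; [exact: FA|exact: HN].
(* [Z] bounds [|X_ n|] where [|Y| <= M]: off [A] by [e / 3], on [A] by the bound [M] of the
   majorant. The rest is the tail of [Y]. *)
pose Z w := e / 3 + (M%:R + 1) * \1_A w.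
have mZ : gmeasurable (F T) Z.
  apply: measurable_funD; first exact: measurable_cst.
  by apply: measurable_funM => //; exact: measurable_cst.
have mYM : gmeasurable (F T) (fun w => \1_[set v | M%:R < `|Y v|] w * Y w).
  by apply: measurable_funM => //; exact: gmeasurable_indic.
have Z0 w : 0 <= Z w by rewrite addr_ge0 ?(ltW e3)// mulr_ge0// ltW.
have -> : e%:E = ((e / 3)%:E + ((e / 3)%:E + (e / 3)%:E))%E.
  by rewrite -!EFinD; congr EFin; lra.
apply: (@le_trans _ _ (c (fun w => \1_[set v | M%:R < `|Y v|] w * Y w)%R + c Z)%E).
  apply: le_cnormD => //.
  apply: filterS (XY n) => w XYw.
  have [wB|wB] := pselect (M%:R < `|Y w|).
    by rewrite indicE mem_set//= mul1r (le_trans XYw)// lerDl.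
  rewrite indicE memNset//= mul0r normr0 add0r (ger0_norm (Z0 w)).
  move/negP: wB; rewrite -leNgt => YM.
  have [wA|wA] := pselect (A w).
    by rewrite /Z indicE mem_set//= mulr1; have := ltW e3; lra.
  by rewrite /Z indicE memNset//= mulr0 addr0; move/negP: wA; rewrite -leNgt.
apply: leeD => //.
apply: (@le_trans _ _ (c (cst (e / 3)%R) + c (fun w => (M%:R + 1) * \1_A w)%R)%E).
  apply: le_cnormD => //.
  - exact: measurable_cst.
  - by apply: measurable_funM => //; exact: measurable_cst.
  - by apply/nearW => w; exact: ler_normD.
apply: leeD; first by apply: cnorm_cst; exact: ltW.
apply: (le_trans (cnormZ _ _ (ltW M1) mA)).
apply: (@le_trans _ _ ((M%:R + 1)%:E * (e / 3 / (M%:R + 1))%:E)%E).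
  by apply: lee_wpmul2l => //; rewrite lee_fin ltW.
by rewrite -EFinM mulrC mulfVK// gt_eqF.
Qed.

(** * The extended risk measure and the hedging problem *)

Context {rhot : R -> R -> (Om -> R) -> (Om -> R)}.
Context (hrhot : is_extension P T F p rho rhot).
Context {s t : R} (hs : 0 <= s) (hst : s <= t) (ht : t <= T).

Let sT : 0 <= s <= T. Proof. by rewrite hs (le_trans hst). Qed.
Let tT : 0 <= t <= T. Proof. by rewrite (le_trans hs hst). Qed.

Local Notation Lct := (Lc P T F p rho t).
Local Notation Loo := (Lp P (F t) +oo%E).

Lemma rhot_Lc X : Lct X -> Lc P T F p rho s (rhot s t X).
Proof. by have [H _ _] := hrhot s t hs hst ht; exact: H. Qed.

Lemma rhot_gmeasurable X : Lct X -> gmeasurable (F s) (rhot s t X).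
Proof. by move=> /rhot_Lc[]. Qed.

Lemma rhot_gmeasurable_T X : Lct X -> gmeasurable (F T) (rhot s t X).
Proof. by move=> /rhot_Lc[mX _]; exact: gmeasurable_T mX. Qed.

Lemma rhot_rho X : Loo X -> {ae P, forall w, rhot s t X w = rho s t X w}.
Proof.
have [_ H _] := hrhot s t hs hst ht => LX; apply: H.
by apply: Lp_oo_fin LX => //; exact: filtration_measurable.
Qed.

Lemma rhot_lip X Y : Lct X -> Lct Y ->
  (c (fun w => rhot s t X w - rhot s t Y w)%R <= c (fun w => X w - Y w)%R)%E.
Proof. by have [_ _ H] := hrhot s t hs hst ht; exact: H. Qed.

Lemma rhot_addr X k : Loo X ->
  {ae P, forall w, rhot s t (fun v => X v + k) w = rhot s t X w - k}.
Proof.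
move=> LX.
have LXk : Loo (fun v => X v + k).
  have := Lp_ooB (F t) X (cst (- k)) LX _.
  rewrite (_ : (fun w => X w - cst (- k) w) = (fun v => X v + k)).
    apply; apply/Lp_ooP; split; first exact: measurable_cst.
    by exists `|k| => //; apply/nearW => w /=; rewrite normrN.
  by apply/funext => w; rewrite opprK.
have [_ _ _ tr] := hrho s t hs hst ht.
have h1 := rhot_rho _ LXk; have h2 := rhot_rho _ LX.
have h3 : {ae P, forall w,
    rho s t (fun v => X v + cst k v) w = rho s t X w - cst k w}.
  apply: tr.
    by apply: Lp_oo_fin LX => //; exact: filtration_measurable.
  apply: Lp_oo_fin => //; first exact: filtration_measurable.
  apply/Lp_ooP; split; first exact: measurable_cst.
  by exists `|k| => //; apply/nearW => w /=.
by apply: filterS3 h1 h2 h3 => w -> -> ->.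
Qed.

(* A bounded perturbation supported off [A] is dominated by the [F_s]-measurable
   variable [2 K 1_(~A)], which translation invariance takes out. *)
Lemma rho_le_on A X Y : F s A -> Loo X -> Loo Y ->
  {ae P, forall w, A w -> Y w <= X w} ->
  {ae P, forall w, A w -> rho s t X w <= rho s t Y w}.
Proof.
move=> FA LX LY YX; have [_ mono _ tr] := hrho s t hs hst ht.
have [mX [K K0 XK]] := (Lp_ooP P _ X).1 LX.
have [mY [L L0 YL]] := (Lp_ooP P _ Y).1 LY.
pose f w := - ((K + L) * \1_(~` A) w).
have Fts : F t `<=` measurable by exact: filtration_measurable.
have LfG u : 0 <= u <= T -> F u A -> Lp P (F u) +oo%E f.
  move=> uT FuA; apply/Lp_ooP; split.
    apply: measurable_funN; apply: measurable_funM; first exact: measurable_cst.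
    by apply: gmeasurable_indic => //; exact: filtrationC.
  exists (K + L); first exact: addr_ge0.
  apply/nearW => w; rewrite /f normrN normrM ger0_norm ?addr_ge0//.
  by rewrite -[leRHS]mulr1 ler_wpM2l ?addr_ge0// indicE ger0_norm// lern1 leq_b1.
have Lf : Lp P (F s) +oo%E f by exact: LfG.
have Lft : Loo f by apply: LfG => //; exact: filtration_sub FA.
have LYf : Loo (fun w => Y w + f w).
  (* Closure is available for differences, so [Y + f] is obtained as [Y - ((Y - Y) - f)]. *)
  have := Lp_ooB _ _ _ LY (Lp_ooB _ _ _ (Lp_ooB _ _ _ LY LY) Lft).
  rewrite (_ : (fun w => _) = (fun w => Y w + f w))//.
  by apply/funext => w; rewrite subrr sub0r opprK.
have Lfin X' : Loo X' -> Lp P (F t) p%:E X' by exact: Lp_oo_fin.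
have h1 : {ae P, forall w, rho s t X w <= rho s t (fun w => Y w + f w) w}.
  apply: mono; [exact: Lfin|exact: Lfin|].
  apply: filterS3 XK YL YX => w.
  rewrite !ler_norml => /andP[XK1 XK2] /andP[YL1 YL2] YX.
  have [wA|wA] := pselect (A w).
    by rewrite /f indicE memNset ?mulr0 ?subr0; [exact: YX|apply].
  by rewrite /f indicE mem_set// mulr1; lra.
have h2 : {ae P, forall w, rho s t (fun w => Y w + f w) w = rho s t Y w - f w}.
  apply: tr; first exact: Lfin.
  by apply: Lp_oo_fin Lf => //; exact: filtration_measurable.
apply: filterS2 h1 h2 => w + E wA; rewrite E /f indicE memNset; last by apply.
by rewrite mulr0 oppr0 subr0.
Qed.

(** Order on [A] passes to [L^c] by truncation, which is nondecreasing and hence keeps [Y <= X] on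
    [A]. For the bounded truncations the excess on [A] is not positive, so the excess [D] is at most
    the sum of the two approximation errors, both controlled by contraction. *)
Lemma rhot_le_on A X Y : F s A -> Lct X -> Lct Y ->
  {ae P, forall w, A w -> Y w <= X w} ->
  {ae P, forall w, A w -> rhot s t X w <= rhot s t Y w}.
Proof.
move=> FA LX LY YX.
pose D w := \1_A w * Num.max 0 (rhot s t X w - rhot s t Y w).
have FTA : F T A by apply: filtration_sub FA => //; exact: le_trans ht.
have [mX _] := LX; have [mY _] := LY.
have mrX := rhot_gmeasurable_T _ LX; have mrY := rhot_gmeasurable_T _ LY.
have mD : gmeasurable (F T) D.
  apply: measurable_funM; first exact: gmeasurable_indic.
  by apply: measurable_maxr; [exact: measurable_cst|exact: measurable_funB].
suff D0 : {ae P, forall w, D w = 0}.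
  apply: filterS D0 => w + wA; rewrite /D indicE mem_set// mul1r => D0.
  by rewrite -subr_le0 -D0 le_max lexx orbT.
apply: cnorm_eq0 => // e e0; have e2 : 0 < e / 2 by rewrite divr_gt0.
have nn (V : Om -> R) : {ae P, forall w, `|V w| <= `|V w|} by exact/nearW.
have [N1 HN1] := trunc_cvg t X X tT LX mX (nn _) _ e2.
have [N2 HN2] := trunc_cvg t Y Y tT LY mY (nn _) _ e2.
pose n := maxn N1 N2.
have cX := HN1 n (leq_maxl _ _); have cY := HN2 n (leq_maxr _ _).
have LX' : Loo (trunc n X) by exact: trunc_Lp.
have LY' : Loo (trunc n Y) by exact: trunc_Lp.
have LX'' := Lp_oo_Lc _ _ LX'; have LY'' := Lp_oo_Lc _ _ LY'.
have mrX' := rhot_gmeasurable_T _ LX''; have mrY' := rhot_gmeasurable_T _ LY''.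
rewrite [e]splitr EFinD.
apply: (@le_trans _ _ (c (fun w => rhot s t X w - rhot s t (trunc n X) w)%R +
                       c (fun w => rhot s t Y w - rhot s t (trunc n Y) w)%R)%E).
  apply: le_cnormD => //; [exact: measurable_funB|exact: measurable_funB|].
  have h : {ae P, forall w, A w -> rho s t (trunc n X) w <= rho s t (trunc n Y) w}.
    apply: rho_le_on => //; apply: filterS YX => w YX wA; apply: trunc_le.
    exact: YX.
  apply: filterS3 h (rhot_rho _ LX') (rhot_rho _ LY') => w h E1 E2.
  have [wA|wA] := pselect (A w); last first.
    by rewrite /D indicE memNset// mul0r normr0 addr_ge0.
  rewrite /D indicE mem_set// mul1r.
  have := h wA; rewrite -E1 -E2 => h'.
  rewrite ger0_norm ?le_max ?lexx// ge_max addr_ge0//=.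
  have := ler_norm (rhot s t X w - rhot s t (trunc n X) w).
  have := ler_norm (- (rhot s t Y w - rhot s t (trunc n Y) w)).
  by rewrite normrN; lra.
apply: leeD.
  by apply: le_trans cX; apply: rhot_lip.
by apply: le_trans cY; apply: rhot_lip.
Qed.

Lemma rhot_eq_on A X Y : F s A -> Lct X -> Lct Y ->
  {ae P, forall w, A w -> X w = Y w} ->
  {ae P, forall w, A w -> rhot s t X w = rhot s t Y w}.
Proof.
move=> FA LX LY XY.
have h1 : {ae P, forall w, A w -> rhot s t X w <= rhot s t Y w}.
  by apply: rhot_le_on => //; apply: filterS XY => w XY wA; rewrite XY.
have h2 : {ae P, forall w, A w -> rhot s t Y w <= rhot s t X w}.
  by apply: rhot_le_on => //; apply: filterS XY => w XY wA; rewrite XY.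
apply: filterS2 h1 h2 => w h1 h2 wA.
by apply/eqP; rewrite eq_le h1// h2.
Qed.

(** * The least hedged risk [U] over an abstract set of bounded hedges *)

Context {C : set (Om -> R)} (hC0 : C !=set0) (hCL : C `<=` Loo).

Let risks X : set (Om -> \bar R) :=
  [set (EFin \o rhot s t (fun v => g v - X v)) | g in C].
Let U X := essinf_fam P (F s) (risks X).

Lemma Lc_hedged g X : C g -> Lct X -> Lct (fun v => g v - X v).
Proof. by move=> /hCL /(Lp_oo_Lc t) Lg LX; exact: (LcB t). Qed.

Lemma U_essinf X : Lct X -> is_essinf P (F s) (risks X) (U X).
Proof.
move=> LX; apply: essinf_famP; first exact: filtration_measurable.
  by have [g Cg] := hC0; exists (EFin \o rhot s t (fun v => g v - X v)); exists g.
move=> _ [g Cg <-]; apply/measurable_EFinP.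
by apply: rhot_gmeasurable; exact: Lc_hedged.
Qed.

Lemma gmeasurable_U X : Lct X -> gmeasurable (F s) (U X).
Proof. by move=> /U_essinf[]. Qed.

Lemma U_le X g : Lct X -> C g ->
  {ae P, forall w, (U X w <= (rhot s t (fun v => g v - X v) w)%:E)%E}.
Proof.
move=> /U_essinf[_ + _] Cg => /(_ (EFin \o rhot s t (fun v => g v - X v))).
by apply; exists g.
Qed.

Lemma le_U X (V : Om -> \bar R) : Lct X -> gmeasurable (F s) V ->
  (forall g, C g ->
    {ae P, forall w, (V w <= (rhot s t (fun v => g v - X v) w)%:E)%E}) ->
  {ae P, forall w, (V w <= U X w)%E}.
Proof. by move=> /U_essinf[_ _ H] mV VC; apply: H => // _ [g Cg <-]; exact: VC. Qed.

Lemma le_U_mono X Y : Lct X -> Lct Y -> {ae P, forall w, X w <= Y w} ->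
  {ae P, forall w, (U X w <= U Y w)%E}.
Proof.
move=> LX LY XY; apply: le_U => //; first exact: gmeasurable_U.
move=> g Cg.
have h : {ae P, forall w, [set: Om] w ->
    rhot s t (fun v => g v - X v) w <= rhot s t (fun v => g v - Y v) w}.
  apply: rhot_le_on; [exact: filtrationT|exact: Lc_hedged|exact: Lc_hedged|].
  by apply: filterS XY => w XY _; rewrite lerD2l lerN2.
apply: filterS2 h (U_le _ _ LX Cg) => w /(_ Logic.I) h1 h2.
by apply: le_trans h2 _; rewrite lee_fin.
Qed.

(* Pasting finitely many [g]'s along [F_s]-events stays in [L_oo(F_t)] (it need
   not stay in [C]); locality makes it nearly optimal for [X], whereas for [Y] it
   still dominates the essential infimum over [C]. *)
Lemma pasting X Y (g : nat -> Om -> R) : Lct X -> Lct Y -> (forall n, C (g n)) ->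
  forall N, exists G, [/\ Loo G,
    forall i, (i <= N)%N ->
      {ae P, forall w,
        rhot s t (fun v => G v - X v) w <= rhot s t (fun v => g i v - X v) w}
    & {ae P, forall w, (U Y w <= (rhot s t (fun v => G v - Y v) w)%:E)%E}].
Proof.
move=> LX LY Cg; elim=> [|N [G [LG GX GY]]].
  exists (g 0%N); split; [exact: hCL| |exact: U_le].
  by move=> i; rewrite leqn0 => /eqP ->; apply/nearW => w.
pose h := g N.+1; have Lh : Loo h by exact: (hCL _ (Cg N.+1)).
have LcD V W : Loo V -> Lct W -> Lct (fun v => V v - W v).
  by move=> /(Lp_oo_Lc t) LV LW; exact: (LcB t).
pose A := [set w | rhot s t (fun v => h v - X v) w < rhot s t (fun v => G v - X v) w].
have FA : F s A.
  by apply: filtration_lt => //; apply: rhot_gmeasurable; exact: LcD.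
have FtA : F t A by exact: filtration_sub FA.
pose H w := \1_A w * h w + \1_(~` A) w * G w.
have HA w : A w -> H w = h w.
  by move=> wA; rewrite /H !indicE mem_set// memNset ?mul1r ?mul0r ?addr0//; apply.
have HNA w : ~ A w -> H w = G w.
  by move=> wA; rewrite /H !indicE memNset// mem_set// mul1r mul0r add0r.
have LH : Loo H.
  have [mh [K K0 hK]] := (Lp_ooP P _ h).1 Lh.
  have [mG [L L0 GL]] := (Lp_ooP P _ G).1 LG.
  apply/Lp_ooP; split.
    apply: measurable_funD; apply: measurable_funM => //.
      exact: gmeasurable_indic.
    by apply: gmeasurable_indic => //; exact: filtrationC.
  exists (K + L); first exact: addr_ge0.
  apply: filterS2 hK GL => w hK GL; have [/HA ->|/HNA ->] := pselect (A w).
    by apply: (le_trans hK); rewrite lerDl.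
  by apply: (le_trans GL); rewrite lerDr.
have eqA V : Lct V -> {ae P, forall w, A w ->
    rhot s t (fun v => H v - V v) w = rhot s t (fun v => h v - V v) w}.
  move=> LV.
  apply: (rhot_eq_on A _ _ FA (LcD H V LH LV) (LcD h V Lh LV)).
  by apply/nearW => w wA; rewrite HA.
have eqNA V : Lct V -> {ae P, forall w, (~` A) w ->
    rhot s t (fun v => H v - V v) w = rhot s t (fun v => G v - V v) w}.
  move=> LV; have FNA := filtrationC s A sT FA.
  apply: (rhot_eq_on (~` A) _ _ FNA (LcD H V LH LV) (LcD G V LG LV)).
  by apply/nearW => w wA; rewrite HNA.
exists H; split => //.
- move=> i; rewrite leq_eqVlt => /predU1P[->|iN].
    apply: filterS2 (eqA _ LX) (eqNA _ LX) => w e1 e2.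
    have [wA|wA] := pselect (A w); first by rewrite e1.
    by rewrite e2//; move/negP: wA; rewrite -leNgt.
  apply: filterS3 (eqA _ LX) (eqNA _ LX) (GX i iN) => w e1 e2 GXi.
  have [wA|wA] := pselect (A w); last by rewrite e2.
  by rewrite e1//; apply: ltW; exact: lt_le_trans GXi.
- apply: filterS3 (eqA _ LY) (eqNA _ LY) _; last first.
    by apply: filterS2 GY (U_le _ _ LY (Cg N.+1)) => w; exact: conj.
  move=> w e1 e2 [UG Uh]; have [wA|wA] := pselect (A w); first by rewrite e1.
  by rewrite e2.
Qed.

(** Here [U X] may still be [-oo], hence an integral of extended variables under one [Q]. If [G n]
    pastes the first members of a minimizing sequence for [X], then [U Y - r n X <= r n Y - r n X],
    whose positive part is bounded by contraction uniformly in [n]; Fatou's lemma passes to the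
    limit. *)
Lemma integral_U_le X Y Q : Lct X -> Lct Y -> calQ Q ->
  {ae P, forall w, U Y w \is a fin_num} ->
  (\int[Q]_w maxe 0 (U Y w - U X w) <= c (fun w => X w - Y w)%R)%E.
Proof.
move=> LX LY QQ UYfin.
have mUT V : Lct V -> measurable_fun (setT : set OT) (U V).
  by move=> LV; apply: gmeasurable_T sT (gmeasurable_U _ LV).
have Ss : risks X !=set0.
  by have [g Cg] := hC0; exists (EFin \o rhot s t (fun v => g v - X v)); exists g.
have mS (V : Om -> \bar R) : risks X V -> gmeasurable (F s) V.
  move=> [g Cg <-]; apply/measurable_EFinP.
  by apply: rhot_gmeasurable; exact: Lc_hedged.
have [f Sf [mf fle _]] := essinf_seq P _ _ (filtration_measurable _ sT) Ss mS.
have fU : {ae P, forall w, (ereal_inf (range (f^~ w)) <= U X w)%E}.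
  by apply: le_U => // g Cg; apply: fle; exists g.
have Sf' n : exists g, C g /\ EFin \o rhot s t (fun v => g v - X v) = f n.
  by have [g Cg E] := Sf n; exists g.
have [g Hg] := choice Sf'.
have Cg n : C (g n) by have [] := Hg n.
have fE n w : f n w = (rhot s t (fun v => g n v - X v) w)%:E by have [_ <-] := Hg n.
have [G HG] := choice (pasting X Y g LX LY Cg).
have LG n : Loo (G n) by have [] := HG n.
have LGD n V : Lct V -> Lct (fun v => G n v - V v).
  by move=> LV; exact: (LcB t _ _ tT (Lp_oo_Lc t _ (LG n)) LV).
pose r n V := rhot s t (fun v => G n v - V v).
have mr n V : Lct V -> measurable_fun (setT : set OT) (r n V).
  by move=> LV; apply: rhot_gmeasurable_T; exact: LGD.
pose D n w := maxe 0%E (U Y w - (r n X w)%:E)%E.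
have D0 n w : (0 <= D n w)%E by rewrite le_max lexx.
have mD n : measurable_fun (setT : set OT) (D n).
  apply: measurable_maxe; first exact: measurable_cst.
  by apply: emeasurable_funB; [exact: mUT|apply/measurable_EFinP; exact: mr].
have iD n : (\int[Q]_w D n w <= c (fun w => X w - Y w)%R)%E.
  apply: (@le_trans _ _ (c (fun w => r n X w - r n Y w)%R)); last first.
    apply: (le_trans (rhot_lip _ _ (LGD n X LX) (LGD n Y LY))).
    apply: le_cnorm.
    - apply: (gmeasurable_T t) => //; apply: Lc_gmeasurable.
      exact: (LcB t _ _ tT (LGD n X LX) (LGD n Y LY)).
    - by apply: (gmeasurable_T t) => //; apply: Lc_gmeasurable; exact: (LcB t).
    - apply/nearW => w.
      rewrite (_ : G n w - X w - (G n w - Y w) = - (X w - Y w)) ?normrN//.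
      by ring.
  apply: le_trans (integral_le_cnorm Q _ QQ).
  apply: ae_ge0_le_integral => //.
    apply: measurableT_comp => //; apply/measurable_EFinP.
    by apply: measurable_funB; exact: mr.
  apply/(calQ_ae QQ); have [_ _ UYG] := HG n.
  apply: filterS UYG => w UYG _; rewrite /D ge_max; apply/andP; split.
    by rewrite lee_fin.
  apply: (@le_trans _ _ ((r n Y w)%:E - (r n X w)%:E)%E); first by rewrite leeB.
  by rewrite -EFinB lee_fin -normrN opprB ler_norm.
(* For fixed [i], [r n X <= f i] as soon as [n >= i], so the liminf of [D n] is at least
   [U Y - f i]; then the infimum over [i] is taken. *)
have DD : {ae P, forall w, (maxe 0 (U Y w - U X w) <= limn_einf (D^~ w))%E}.
  have /ae_foralln GXP : forall n, {ae P, forall w, forall i, (i <= n)%N ->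
      r n X w <= rhot s t (fun v => g i v - X v) w}.
    move=> n; apply: ae_foralln => i; have [ni|ni] := leqP i n; last first.
      by apply/nearW.
    by have [_ /(_ i ni) + _] := HG n; apply: filterS => w + _.
  apply: filterS3 fU UYfin GXP => w fU UYfin GXP.
  have L0 : (0 <= limn_einf (D^~ w))%E by apply: (limn_einf_ge _ 0%N).
  rewrite ge_max L0/=.
  have HL i : (U Y w - f i w <= limn_einf (D^~ w))%E.
    apply: (limn_einf_ge _ i) => k ik; rewrite /D le_max; apply/orP; right.
    by rewrite fE leeB// lee_fin; exact: GXP.
  (* Where the liminf is a real [l], [U Y - l] is a real lower bound of all [f i], hence of [U X];
     this excludes [U X = -oo] there. *)
  move: L0 HL; case: (limn_einf _) => [l| |]// L0 HL; last by rewrite leey.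
  rewrite -(fineK UYfin) in HL *.
  have : ((fine (U Y w))%:E - l%:E <= U X w)%E.
    apply: le_trans fU; apply: le_ereal_inf_tmp => _ [i _ <-].
    by have := HL i; rewrite fE -!EFinB !lee_fin; lra.
  case: (U X w) => [x| |]//; rewrite -?EFinB ?lee_fin; first lra.
  by rewrite leNye.
have mlim : measurable_fun (setT : set OT) (fun w => limn_einf (D^~ w)).
  apply: measurableT_comp => //; apply: measurable_fun_limn_esup => n.
  by apply: measurableT_comp => //; exact: mD.
apply: (@le_trans _ _ (\int[Q]_w limn_einf (D^~ w))%E).
  apply: ae_ge0_le_integral => //.
  - by move=> w _; rewrite le_max lexx.
  - apply: measurable_maxe; first exact: measurable_cst.
    by apply: emeasurable_funB; exact: mUT.
  - by move=> w _; apply: (limn_einf_ge _ 0%N).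
  - by apply/(calQ_ae QQ); apply: filterS DD => w + _.
apply: (le_trans (fatou Q measurableT mD (fun n w _ => D0 n w))).
by apply: limn_einf_le => n; exact: iD.
Qed.

(** The form in which the standing assumption enters: an a.s. lower bound above [-oo] for the risks
    of the hedges. In the application [V] is the essential infimum over the larger set of
    [p]-integrable hedges. *)
Context {V : Om -> \bar R} (mV : gmeasurable (F s) V).
Context (Vfin : {ae P, forall w, (-oo < V w)%E}).
Context (VC : forall g, C g -> {ae P, forall w, (V w <= (rho s t g w)%:E)%E}).

Let Lct0 : Lct (cst 0).
Proof.
apply: Lp_oo_Lc; apply/Lp_ooP; split; first exact: measurable_cst.
by exists 0 => //; apply/nearW => w; rewrite normr0.
Qed.

Lemma U_lty X : Lct X -> {ae P, forall w, (U X w < +oo)%E}.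
Proof.
move=> LX; have [g Cg] := hC0.
by apply: filterS (U_le _ _ LX Cg) => w /le_lt_trans; apply; exact: ltry.
Qed.

Lemma U0_fin : {ae P, forall w, U (cst 0%R) w \is a fin_num}.
Proof.
have h : {ae P, forall w, (V w <= U (cst 0%R) w)%E}.
  apply: le_U => // g Cg; rewrite (_ : (fun v => g v - cst 0 v) = g).
    by apply: filterS2 (VC _ Cg) (rhot_rho _ (hCL _ Cg)) => w + ->.
  by apply/funext => w; rewrite subr0.
apply: filterS3 h Vfin (U_lty _ Lct0) => w h1 h2 h3.
by rewrite fin_real// (lt_le_trans h2 h1).
Qed.

(** Only [U X = -oo] has to be excluded: [integral_U_le] with [Y = 0] makes [(U 0 - U X)^+]
    integrable under some [Q] equivalent to [P], and [U 0] is finite. *)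
Lemma U_fin X : Lct X -> {ae P, forall w, U X w \is a fin_num}.
Proof.
move=> LX; have [Q QQ] := hsens.
have mUT Y : Lct Y -> measurable_fun (setT : set OT) (U Y).
  by move=> LY; apply: gmeasurable_T sT (gmeasurable_U _ LY).
pose D w := maxe 0%E (U (cst 0%R) w - U X w)%E.
have D0 w : (0 <= D w)%E by rewrite le_max lexx.
have mD : measurable_fun (setT : set OT) D.
  apply: measurable_maxe; first exact: measurable_cst.
  by apply: emeasurable_funB; exact: mUT.
have iD : Q.-integrable [set: OT] D.
  apply/integrableP; split => //; under eq_integral do rewrite gee0_abs//.
  apply: le_lt_trans (integral_U_le X (cst 0%R) Q LX Lct0 QQ U0_fin) _.
  exact: (cnorm_Lc_fin t _ tT (LcB t _ _ tT LX Lct0)).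
have /(calQ_ae QQ) H := integrable_ae measurableT iD.
have Dfin : {ae P, forall w, D w \is a fin_num} by apply: ae_imp H => w; apply.
apply: filterS3 Dfin U0_fin (U_lty _ LX) => w + U0 UX.
by rewrite /D -(fineK U0); case: (U X w) UX => // _; rewrite /= maxey.
Qed.

Lemma U_lip X Y : Lct X -> Lct Y ->
  (c (fun w => Num.max 0 (fine (U Y w) - fine (U X w)))%R <=
   c (fun w => X w - Y w)%R)%E.
Proof.
move=> LX LY; apply: cnorm_le => Q QQ.
apply: le_trans (integral_U_le X Y Q LX LY QQ (U_fin _ LY)).
have mUT Z : Lct Z -> measurable_fun (setT : set OT) (U Z).
  by move=> LZ; apply: gmeasurable_T sT (gmeasurable_U _ LZ).
have mfU Z : Lct Z -> measurable_fun (setT : set OT) (fun w => fine (U Z w)).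
  by move=> LZ; apply: measurableT_comp => //; exact: mUT.
apply: ae_ge0_le_integral => //.
- apply: measurableT_comp => //; apply/measurable_EFinP.
  apply: measurable_maxr; first exact: measurable_cst.
  by apply: measurable_funB; exact: mfU.
- by move=> w _; rewrite le_max lexx.
- apply: measurable_maxe; first exact: measurable_cst.
  by apply: emeasurable_funB; exact: mUT.
apply/(calQ_ae QQ); apply: filterS2 (U_fin _ LX) (U_fin _ LY) => w UX UY _.
rewrite -(fineK UX) -(fineK UY) /= -EFinB -EFin_max.
by rewrite lee_fin ger0_norm// le_max lexx.
Qed.

(** Translation invariance gives [U k = U 0 + k] for constants, and monotonicity squeezes [U B]
    between [U (- K)] and [U K]. This supplies the bounded approximants of prices. *)
Lemma U_bounded B : Loo B -> exists2 K : R, 0 <= K &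
  {ae P, forall w, `|fine (U B w) - fine (U (cst 0%R) w)| <= K}.
Proof.
move=> LB; have [mB [K K0 BK]] := (Lp_ooP P _ B).1 LB.
exists K => //; have LB' := Lp_oo_Lc _ _ LB.
have shift g k : C g -> {ae P, forall w, rhot s t (fun v => g v - cst k v) w
    = rhot s t (fun v => g v - cst 0 v) w + k}.
  move=> Cg; rewrite (_ : (fun v => g v - cst 0 v) = g); last first.
    by apply/funext => v; rewrite subr0.
  by apply: filterS (rhot_addr g (- k) (hCL _ Cg)) => w ->; rewrite opprK.
have Lcst k : Lct (cst k).
  apply: Lp_oo_Lc; apply/Lp_ooP; split; first exact: measurable_cst.
  by exists `|k| => //; apply/nearW => w.
have mUk k : gmeasurable (F s) (fun w => U (cst 0%R) w + k%:E)%E.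
  by apply: emeasurable_funD; [exact: gmeasurable_U|exact: measurable_cst].
have UK_ge k : {ae P, forall w, (U (cst 0%R) w + k%:E <= U (cst k) w)%E}.
  apply: (le_U _ _ (Lcst k) (mUk k)) => g Cg.
  apply: filterS2 (shift g k Cg) (U_le _ _ Lct0 Cg) => w ->.
  by rewrite EFinD => h; apply: leeD.
have UK_le k : {ae P, forall w, (U (cst k) w - k%:E <= U (cst 0%R) w)%E}.
  apply: (le_U _ _ Lct0).
    by apply: emeasurable_funB; [exact: gmeasurable_U|exact: measurable_cst].
  move=> g Cg; apply: filterS2 (shift g k Cg) (U_le _ _ (Lcst k) Cg) => w ->.
  by rewrite EFinD leeBlDr.
have UB1 : {ae P, forall w, (U B w <= U (cst K) w)%E}.
  apply: (le_U_mono _ _ LB' (Lcst K)); apply: filterS BK => w.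
  by apply: le_trans; exact: ler_norm.
have UB2 : {ae P, forall w, (U (cst (- K)%R) w <= U B w)%E}.
  apply: (le_U_mono _ _ (Lcst (- K)) LB'); apply: filterS BK => w.
  by rewrite ler_norml => /andP[].
have h1 : {ae P, forall w, (U B w <= U (cst 0%R) w + K%:E)%E}.
  by apply: filterS2 UB1 (UK_le K) => w h1; rewrite leeBlDr//; exact: le_trans.
have h2 : {ae P, forall w, (U (cst 0%R) w + (- K)%:E <= U B w)%E}.
  by apply: filterS2 UB2 (UK_ge (- K)) => w h h'; exact: le_trans h.
apply: filterS3 (U_fin _ LB') U0_fin _; last first.
  by apply: filterS2 h1 h2 => w; exact: conj.
move=> w UB U0 []; rewrite -(fineK UB) -(fineK U0) -!EFinD !lee_fin /= ler_norml.
lra.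
Qed.

(** * The real-valued price and its Fatou property *)

Let u X w := fine (U X w) - fine (U (cst 0%R) w).

Lemma gmeasurable_u X : Lct X -> gmeasurable (F s) (u X).
Proof.
move=> LX; apply: measurable_funB; apply: measurableT_comp => //.
  exact: gmeasurable_U.
exact: gmeasurable_U.
Qed.

Lemma u_Lc X : Lct X -> Lc P T F p rho s (u X).
Proof.
move=> LX; split; first exact: gmeasurable_u.
move=> e e0; have e2 : 0 < e / 2 by rewrite divr_gt0.
have [_ /(_ _ e2)[B LB XB]] := LX; have LB' := Lp_oo_Lc _ _ LB.
have [K K0 BK] := U_bounded B LB.
exists (u B).
  by apply/Lp_ooP; split; [exact: gmeasurable_u|exists K].
have mfU Z : Lct Z -> gmeasurable (F T) (fun w => fine (U Z w)).
  move=> LZ; apply: (gmeasurable_T s) => //; apply: measurableT_comp => //.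
  exact: gmeasurable_U.
have mmax Z Z' : Lct Z -> Lct Z' ->
    gmeasurable (F T) (fun w => Num.max 0 (fine (U Z w) - fine (U Z' w))).
  move=> LZ LZ'; apply: measurable_maxr; first exact: measurable_cst.
  by apply: measurable_funB; exact: mfU.
have XB' : (c (fun w => B w - X w)%R <= (e / 2)%:E)%E.
  apply: le_trans XB; have [mX _] := LX; have [mB _] := LB.
  apply: le_cnorm; [| |by apply/nearW => w; rewrite distrC].
  - by apply: (gmeasurable_T t) => //; exact: measurable_funB.
  - by apply: (gmeasurable_T t) => //; exact: measurable_funB.
rewrite [e]splitr EFinD.
(* In [u X - u B] the term [U 0] cancels, and the absolute value is covered by the two positive
   parts, each within [e / 2]. *)
apply: le_trans (leeD (le_trans (U_lip X B LX LB') XB)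
                      (le_trans (U_lip B X LB' LX) XB')).
apply: le_cnormD; [|exact: mmax|exact: mmax|].
  by apply: (gmeasurable_T s) => //; apply: measurable_funB; exact: gmeasurable_u.
apply/nearW => w; rewrite /u opprB addrA subrK.
set a := fine (U X w); set b := fine (U B w).
rewrite [X in _ <= X + _]ger0_norm ?le_max ?lexx//.
rewrite [X in _ <= _ + X]ger0_norm ?le_max ?lexx//.
have h1 : 0 <= Num.max 0 (b - a) by rewrite le_max lexx.
have h2 : b - a <= Num.max 0 (b - a) by rewrite le_max lexx orbT.
have h3 : 0 <= Num.max 0 (a - b) by rewrite le_max lexx.
have h4 : a - b <= Num.max 0 (a - b) by rewrite le_max lexx orbT.
by rewrite ler_norml; lra.
Qed.

Lemma price_u X : Lct X ->
  {ae P, forall w, (U X w - U (cst 0%R) w)%E = (u X w)%:E}.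
Proof.
move=> LX; apply: filterS2 (U_fin _ LX) U0_fin => w UX U0.
by rewrite -(fineK UX) -(fineK U0) -EFinB.
Qed.

Lemma u_fatou (Xn : nat -> Om -> R) X Y :
  (forall n, Lct (Xn n)) -> Lct X -> Lct Y ->
  (forall n, {ae P, forall w, `|Xn n w| <= Y w}) ->
  {ae P, forall w, Xn n w @[n --> \oo] --> X w} ->
  {ae P, forall w, ((u X w)%:E <= limn_einf (fun n => (u (Xn n) w)%:E))%E}.
Proof.
move=> LXn LX LY XnY XnX.
pose I n w := einfs (fun k => (Xn k w)%:E) n.
pose Z n w := fine (I n w).
have mZ n : gmeasurable (F t) (Z n).
  apply: measurableT_comp => //; apply: measurable_fun_einfs => k.
  by apply/measurable_EFinP; exact: (Lc_gmeasurable t _ (LXn k)).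
have IX n k w : (n <= k)%N -> (I n w <= (Xn k w)%:E)%E.
  by move=> nk; apply: ereal_inf_lbound; exists k.
have Ifin : {ae P, forall w, forall n, I n w \is a fin_num}.
  have /ae_foralln H := XnY; apply: filterS H => w H n.
  rewrite fin_real// (le_lt_trans (IX n n w (leqnn n)) (ltry _)) andbT.
  apply: (@lt_le_trans _ _ (- Y w)%:E); first exact: ltNyr.
  apply: le_ereal_inf_tmp => _ [k _ <-]; rewrite lee_fin.
  by have := H k; rewrite ler_norml => /andP[].
have ZY n : {ae P, forall w, `|Z n w| <= `|Y w|}.
  have /ae_foralln H := XnY; apply: filterS2 Ifin H => w Iw H.
  apply: le_trans (ler_norm (Y w)); rewrite ler_norml; apply/andP; split.
    rewrite -lee_fin fineK//; apply: le_ereal_inf_tmp => _ [k _ <-]; rewrite lee_fin.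
    by have := H k; rewrite ler_norml => /andP[].
  rewrite -lee_fin fineK//; apply: (le_trans (IX n n w (leqnn n))); rewrite lee_fin.
  by have := H n; rewrite ler_norml => /andP[].
have LZ n : Lct (Z n) by exact: (Lc_solid t (Z n) Y tT LY (mZ n) (ZY n)).
have ZX : {ae P, forall w, Z n w @[n --> \oo] --> X w}.
  apply: filterS XnX => w XnX; apply: fine_cvg.
  by apply: cvg_einfs; apply: cvg_EFin => //; exact: nearW.
have LN : Lct (fun w => - `|X w|).
  apply: (Lc_solid t _ X tT LX); last by apply/nearW => w; rewrite normrN normr_id.
  apply: measurable_funN; apply: measurableT_comp => //; exact: Lc_gmeasurable.
(* The majorant [Y + |X|] of [|Z n - X|], written as a difference. *)
have LW := LcB t Y _ tT LY LN.
have mD n : gmeasurable (F t) (fun w => Z n w - X w).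
  exact: measurable_funB (mZ n) (Lc_gmeasurable t X LX).
have cZX : forall e : R, 0 < e -> exists N, forall n, (N <= n)%N ->
    (c (fun w => Z n w - X w)%R <= e%:E)%E.
  apply: (cnorm_dominated_cvg t _ _ tT LW mD).
    move=> n; have /ae_foralln H := XnY; apply: filterS2 (ZY n) H => w ZYw H.
    apply: le_trans (ler_norm _); rewrite opprK; apply: (le_trans (ler_normB _ _)).
    by rewrite lerD2r (le_trans ZYw)// ger0_norm// (le_trans _ (H 0%N)).
  apply: filterS ZX => w ZXw; rewrite -[0](subrr (X w)).
  by apply: cvgB => //; exact: cvg_cst.
pose S n w := Num.max 0 (fine (U X w) - fine (U (Z n) w)).
have S0 n w : 0 <= S n w by rewrite le_max lexx.
have mS n : gmeasurable (F T) (S n).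
  apply: measurable_maxr; first exact: measurable_cst.
  have mfU V' : Lct V' -> gmeasurable (F T) (fun w => fine (U V' w)).
    move=> LV; apply: (gmeasurable_T s) => //; apply: measurableT_comp => //.
    exact: gmeasurable_U.
  exact: measurable_funB (mfU X LX) (mfU _ (LZ n)).
(* The infimum of the deficits replaces an a.s. convergent subsequence: [c J <= c (S n)] for every
   [n], so [J = 0] a.s., and at almost every [w] some [n], depending on [w], has deficit below
   [e]. *)
pose J w := ereal_inf (range (fun n => (S n w)%:E)).
have J0 w : (0 <= J w)%E by apply: le_ereal_inf_tmp => _ [n _ <-]; rewrite lee_fin.
have JS n w : (J w <= (S n w)%:E)%E by apply: ereal_inf_lbound; exists n.
have Jfin w : J w \is a fin_num.
  by rewrite ge0_fin_numE// (le_lt_trans (JS 0%N w))// ltry.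
have mJ : gmeasurable (F T) (fun w => fine (J w)).
  apply: measurableT_comp => //; apply: measurable_inf_range => n.
  by apply/measurable_EFinP; exact: mS.
have JE : {ae P, forall w, fine (J w) = 0}.
  apply: cnorm_eq0 => // e e0; have [N /(_ N (leqnn N)) HN] := cZX e e0.
  apply: le_trans HN; apply: le_trans (U_lip (Z N) X (LZ N) LX).
  apply: le_cnorm; [exact: mJ|exact: mS|apply/nearW => w].
  rewrite (ger0_norm (S0 N w)) ger0_norm ?fine_ge0//.
  by rewrite -lee_fin (fineK (Jfin w)); exact: JS.
have mono : {ae P, forall w, forall n k, (n <= k)%N -> (U (Z n) w <= U (Xn k) w)%E}.
  apply: ae_foralln => n; apply: ae_foralln => k.
  have [nk|nk] := leqP n k; last by apply/nearW.
  have h : {ae P, forall w, (U (Z n) w <= U (Xn k) w)%E}.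
    apply: (le_U_mono _ _ (LZ n) (LXn k)); apply: filterS Ifin => w Iw.
    by rewrite -lee_fin fineK//; exact: IX.
  by apply: filterS h.
have finZX : {ae P, forall w, forall n,
    U (Z n) w \is a fin_num /\ U (Xn n) w \is a fin_num}.
  apply: ae_foralln => n.
  by apply: filterS2 (U_fin _ (LZ n)) (U_fin _ (LXn n)) => w; exact: conj.
apply: filterS3 JE mono finZX => w JE mono finZX.
have uL n : ((u (Z n) w)%:E <= limn_einf (fun n => (u (Xn n) w)%:E))%E.
  apply: (limn_einf_ge _ n) => k nk; rewrite lee_fin lerD2r -lee_fin.
  by rewrite !fineK; [exact: mono|have [] := finZX k|have [] := finZX n].
apply/lee_addgt0Pr => e e0.
have : (J w < e%:E)%E by rewrite -(fineK (Jfin w)) JE lte_fin.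
move=> /ereal_inf_lt[_ [n _ <-]]; rewrite lte_fin => Sn.
apply: le_trans (leeD2r _ (uL n)); rewrite -EFinD lee_fin.
have : fine (U X w) - fine (U (Z n) w) <= S n w by rewrite le_max lexx orbT.
by rewrite /u; lra.
Qed.

(** This is [price] unfolded at [C]. Its second infimum ranges over [rhot s t g] instead of
    [rhot s t (g - 0)]; the two families are the same set of functions. *)
Let pr X w := (essinf_fam P (F s) (risks X) w -
  essinf_fam P (F s) [set (EFin \o rhot s t g) | g in C] w)%E.

Let pr_u X : Lct X -> {ae P, forall w, pr X w = (u X w)%:E}.
Proof.
move=> /price_u; rewrite /pr (_ : [set _ | g in C] = risks (cst 0))//.
by rewrite /risks; congr image; apply/funext => g; congr (_ \o rhot s t _);
  apply/funext => v; rewrite subr0.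
Qed.

Lemma price_Lc X : Lct X -> exists2 Z, Lc P T F p rho s Z &
  {ae P, forall w, pr X w = (Z w)%:E}.
Proof. by move=> LX; exists (u X); [exact: u_Lc|exact: pr_u]. Qed.

Lemma price_fatou (Xn : nat -> Om -> R) X Y :
  (forall n, Lct (Xn n)) -> Lct X -> Lct Y ->
  (forall n, {ae P, forall w, `|Xn n w| <= Y w}) ->
  {ae P, forall w, Xn n w @[n --> \oo] --> X w} ->
  {ae P, forall w, (pr X w <= limn_einf (fun n => pr (Xn n) w))%E}.
Proof.
move=> LXn LX LY XnY XnX.
have /ae_foralln prn : forall n, {ae P, forall w, pr (Xn n) w = (u (Xn n) w)%:E}.
  by move=> n; exact: (pr_u _ (LXn n)).
apply: filterS3 (u_fatou Xn X Y LXn LX LY XnY XnX) (pr_u X LX) prn.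
move=> w + -> prn; rewrite (_ : (fun n => pr _ _) = (fun n => (u (Xn n) w)%:E))//.
exact/funext.
Qed.

End price.

(** That the price maps [L^c_t] into [L^c_s] is itself part of the claim, hence the first conjunct:
    [Z] is a real-valued version of a price defined with extended values. *)
Theorem proposition2p56 (R : realType) (d : measure_display)
    (Om : measurableType d) (P : probability Om R) (T : R) (hT : 0 < T)
    (F : R -> set (set Om)) (hF : complete_filtration P T F)
    (hF0 : trivial_sigma P (F 0))
    (p : R) (hp : 1 <= p)
    (rho : R -> R -> (Om -> R) -> (Om -> R))
    (hrho : convex_risk_measure P T F p rho)
    (htc : strong_time_consistent P T F p rho)
    (hdom : dominated P T F p rho) (hsens : sensitive P T F p rho)
    (rhot : R -> R -> (Om -> R) -> (Om -> R))
    (hrhot : is_extension P T F p rho rhot)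
    (m : nat) (Pi : R -> Om -> 'rV[R]_m)
    (hPia : vadapted T F Pi) (hPib : vlocally_bounded P T F Pi)
    (hPis : vsemimartingale P T F Pi)
    (Theta : set (R -> Om -> 'rV[R]_m))
    (hTheta : admissible_strategies P T F Pi Theta)
    (hfree : no_free_hedge P T F Pi Theta p rho)
    (s t : R) (hs : 0 <= s) (hst : s <= t) (ht : t <= T) :
  (forall X, Lc P T F p rho t X ->
     exists2 Z, Lc P T F p rho s Z &
       {ae P, forall w, price P T F Pi Theta rhot s t X w = (Z w)%:E}) /\
  (forall (Xn : nat -> Om -> R) (X Y : Om -> R),
     (forall n, Lc P T F p rho t (Xn n)) ->
     Lc P T F p rho t X ->
     Lc P T F p rho t Y ->
     (forall n, {ae P, forall w, `|Xn n w| <= Y w}) ->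
     {ae P, forall w, Xn n w @[n --> \oo] --> X w} ->
     {ae P, forall w,
        (price P T F Pi Theta rhot s t X w <=
         limn_einf (fun n => price P T F Pi Theta rhot s t (Xn n) w))%E}).
Proof.
have sT : 0 <= s <= T by rewrite hs (le_trans hst).
have tT : 0 <= t <= T by rewrite (le_trans hs hst).
have [Fm _ _] := hF.
set C := hedgeable P T F Pi Theta +oo%E s t.
have CL : C `<=` Lp P (F t) +oo%E by move=> g [].
have Cp : C `<=` hedgeable P T F Pi Theta p%:E s t.
  move=> g [Lg H]; split => //; apply: Lp_oo_fin Lg; first by have [] := Fm t tT.
  exact: lt_le_trans hp.
(* The gains of the zero strategy are bounded below by a constant [K], by membership in [Xi]; that
   constant is a bounded hedge, whichever version of the integral is chosen. *)
have C0 : C !=set0.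
  have [ThXi Th0 _ _] := hTheta.
  have [Y iY HY] := ThXi _ Th0.
  have [_ [K HK]] := HY s sT.
  exists (cst K); split.
    apply/Lp_ooP; split; first exact: measurable_cst.
    by exists `|K| => //; apply/nearW => w.
  exists (fun=> cst 0), Y; split => //.
  by apply: filterS HK => w /(_ t); apply; rewrite hst.
(* The standing assumption concerns [p]-integrable hedges; since they include the bounded ones,
   their essential infimum is a lower bound over [C] too. *)
pose S := [set (EFin \o rho s t g) | g in hedgeable P T F Pi Theta p%:E s t].
have [mV VS _] : is_essinf P (F s) S (essinf_fam P (F s) S).
  apply: essinf_famP; first by have [] := Fm s sT.
    by have [g /Cp Cg] := C0; exists (EFin \o rho s t g); exists g.
  move=> _ [g [Lg _] <-]; apply/measurable_EFinP.
  by have [H _ _ _] := hrho s t hs hst ht; have [] := H g Lg.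
have VC g : C g ->
    {ae P, forall w, (essinf_fam P (F s) S w <= (rho s t g w)%:E)%E}.
  by move=> /Cp Cg; apply: VS; exists g.
have Vfin := hfree s t hs hst ht.
split=> [X LX|Xn X Y LXn LX LY XnY XnX].
  exact: (price_Lc hT hF hF0 hp hrho hdom hsens hrhot hs hst ht C0 CL
    mV Vfin VC).
exact: (price_fatou hT hF hF0 hp hrho hdom hsens hrhot hs hst ht C0 CL
  mV Vfin VC Xn X Y).
Qed.
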